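(* Let $T>0$, $\Omega_1=(0,\infty)$, $\Omega_2=(-\infty,0)$. Let $H_1,H_2:[0,T]\times\mathbb{R}\times\mathbb{R}\to\mathbb{R}$ satisfy, for $i=1,2$: (i) $H_i(t,x,p)$ is measurable in $t$ and continuous in $(x,p)$; (ii) $H_i(\cdot,0,0)\in L^1(0,T)$; (iii) for each $R>0$ there exist a constant $c_R>0$ and a $t$-measurable modulus $\omega_R$ such that $|H_i(t,x,p)-H_i(t,y,p)|\le c_R|x-y||p|+\omega_R(t,|x-y|)$ for all $|x|,|y|\le R$, $p\in\mathbb{R}$, $t\in[0,T]$; (iv) there exists $c>0$ such that $|H_i(t,x,p)-H_i(t,x,q)|\le c|p-q|$ for all $p,q\in\mathbb{R}$, $x\in\mathbb{R}$, $t\in[0,T]$; (v) $p\mapsto H_i(t,x,p)$ is convex, and coercive uniformly with respect to $(t,x)$; (vi) for every compact subset $Q\subset\mathbb{R}^2$ there exist $h\in L^\infty(0,T)$ and a $t$-integrable modulus $\omega$ such that, for $i=1,2$, all $(x,p),(y,q)\in Q$ and all $t,s\in[0,T]$, $$|H_i(t,x,p)-H_i(s,y,q)|\le |h(s)-h(t)|+\omega(t,|x-y|+|p-q|)+\omega(s,|x-y|+|p-q|).$$ Let $A\in L^\infty([0,T])$ satisfy $A(t)\ge A_0(t):=\max\{\min_{p\in\mathbb{R}}H_1(t,0,p),\min_{p\in\mathbb{R}}H_2(t,0,p)\}$ for a.e. $t\in[0,T]$. Let $u,v$ be continuous bounded functions on $\mathbb{R}\times[0,T)$ such that $u$ is a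 (FL-tm) subsolution and $v$ is a (FL-tm) supersolution in $\mathbb{R}\times(0,T)$ of the junction problem $$u_t+H_1(t,x,u_x)=0\ \text{in }\Omega_1\times(0,T),\qquad u_t+H_2(t,x,u_x)=0\ \text{in }\Omega_2\times(0,T),$$ $$u_t(0,t)+\max\{A(t),H_1^-(t,0,u_x(0^+,t)),H_2^+(t,0,u_x(0^-,t))\}=0\ \text{in }(0,T).$$ Assume that $u$ and $v$ are locally Lipschitz continuous in $x$, uniformly with respect to $t$, and that there exist $C_1,C_2>0$ such that $$u(x,t)\le C_1(1+|x|),\qquad v(x,t)\ge -C_2(1+|x|)\qquad\text{for all }(x,t)\in\mathbb{R}\times(0,T).$$ If $u(x,0)\le v(x,0)$ for all $x\in\mathbb{R}$, then $u(x,t)\le v(x,t)$ for all $(x,t)\in\mathbb{R}\times(0,T)$.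
   Context: **Moduli.** A $t$-measurable modulus is a non-negative function $\omega=\omega(t,k)$ ($t\in[0,T]$, $k\ge0$) that is continuous, subadditive and non-decreasing in $k$ and measurable in $t$, with $\omega(\cdot,k)\in L^1(0,T)$ for all $k$ and $\omega(t,0)=0$ for a.e. $t$. It is a $t$-integrable modulus if moreover $\lim_{\delta\to0}\int_0^T\omega(t,\delta)\,dt=0$. **Monotone parts.** Let $\hat p^i(t,x)$ be a point with $H_i(t,x,\hat p^i(t,x))=\min_pH_i(t,x,p)$. Then $H_i^+$ (nondecreasing part) is defined by $H_i^+(t,x,p)=\min_qH_i(t,x,q)$ if $p\le\hat p^i(t,x)$ and $H_i^+(t,x,p)=H_i(t,x,p)$ otherwise; $H_i^-$ (nonincreasing part) is defined by $H_i^-(t,x,p)=H_i(t,x,p)$ if $p\le\hat p^i(t,x)$ and $H_i^-(t,x,p)=\min_qH_i(t,x,q)$ otherwise. **Test functions.** $PC^1(\mathbb{R}\times(0,T))$ is the set of $\psi\in C(\mathbb{R}\times(0,T))$ for which there exist $\psi_i\in C^1(\overline{\Omega_i}\times(0,T))$, $i=1,2$, with $\psi=\psi_i$ on $\overline{\Omega_i}\times(0,T)$. One writes $\psi_x(0^+,t)=(\psi_1)_x(0,t)$, $\psi_x(0^-,t)=(\psi_2)_x(0,t)$, and $\psi_t(0,t)=(\psi_1)_t(0,t)=(\psi_2)_t(0,t)$. **Flux Limited $t$-measurable (FL-tm) sub/supersolutions.** A continuous bounded function $u:\mathbb{R}\times(0,T)\to\mathbb{R}$ is a (FL-tm) subsolution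 (resp. supersolution) of the junction problem in $\mathbb{R}\times(0,T)$ if the following holds for every $b\in L^1(0,T)$, every $\psi\in PC^1(\mathbb{R}\times(0,T))$ and every local maximum (resp. minimum) point $(x_0,t_0)\in\mathbb{R}\times(0,T)$ of $u(x,t)-\big(\int_0^tb(s)\,ds+\psi(x,t)\big)$. Case 1, $x_0=0$: for every $G_0\in C([0,T]\times\overline{\Omega_1}\times\overline{\Omega_2}\times\mathbb{R}^2)$ such that for some $\delta>0$ $$-b(t)+G_0(t,x_1,x_2,(p_1,p_2))\le\max\{A(t),H_1^-(t,x_1,p_1),H_2^+(t,x_2,p_2)\}\quad(\text{resp. }\ge)$$ for $|p_1-\psi_x(0^+,t_0)|\le\delta$, $|p_2-\psi_x(0^-,t_0)|\le\delta$, $|x_1|,|x_2|\le\delta$ (with $x_i\in\overline{\Omega_i}$), and a.e. $t$ with $|t-t_0|\le\delta$, one has $$\psi_t(0,t_0)+G_0(t_0,0,0,(\psi_x(0^+,t_0),\psi_x(0^-,t_0)))\le0\quad(\text{resp. }\ge0).$$ Case 2, $x_0\in\Omega_i$, $i\in\{1,2\}$: for every $G_i\in C([0,T]\times\Omega_i\times\mathbb{R})$ such that for some $\delta>0$ $$-b(t)+G_i(t,x,p)\le H_i(t,x,p)\quad(\text{resp. }\ge)$$ for $|p-\psi_x(x_0,t_0)|\le\delta$, $|x-x_0|\le\delta$ (with $x\in\Omega_i$), and a.e. $t$ with $|t-t_0|\le\delta$, one has $$\psi_t(x_0,t_0)+G_i(t_0,x_0,\psi_x(x_0,t_0))\le0\quad(\text{resp.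 }\ge0).$$ *)

(* Defs.v *)
From HB Require Import structures.
From mathcomp Require Export all_boot all_order all_algebra.
From mathcomp Require Export all_classical all_reals all_analysis.
Export Order.TTheory GRing.Theory Num.Theory.
Export numFieldNormedType.Exports.

Set Implicit Arguments.
Unset Strict Implicit.
Unset Printing Implicit Defensive.

Local Open Scope classical_set_scope.
Local Open Scope ring_scope.

(* The measure space is the real line with its Lebesgue sigma-algebra (the
   completed one), not the Borel sigma-algebra of [measurableTypeR]. *)
Notation leb R := (@completed_lebesgue_measure R).
Notation lebType R := (caratheodory_type (@wlength R idfun)^*%mu).

Definition Lmeasurable (R : realType) (D : set R) (f : R -> R) : Prop :=
  measurable_fun (D : set (lebType R)) f.

Definition L1 (R : realType) (T : R) (f : R -> R) : Prop :=
  (leb R).-integrable `]0, T[ (EFin \o f).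

Definition Linfty (R : realType) (T : R) (f : R -> R) : Prop :=
  Lmeasurable `]0, T[ f /\
  exists M : R, {ae leb R, forall t : R, t \in `]0, T[ -> `|f t| <= M}.

(* All functions are total; a function of the paper that is only defined on
   some set is constrained on that set only. *)

Definition t_measurable_modulus (R : realType) (T : R) (w : R -> R -> R)
    : Prop :=
  [/\ forall t k : R, t \in `[0, T] -> 0 <= k -> 0 <= w t k,
      forall t : R, t \in `[0, T] ->
        [/\ {within `[0, +oo[, continuous (w t)},
            forall k l : R, 0 <= k -> 0 <= l -> w t (k + l) <= w t k + w t l
          & forall k l : R, 0 <= k -> k <= l -> w t k <= w t l],
      forall k : R, 0 <= k -> Lmeasurable `[0, T] (w^~ k),
      forall k : R, 0 <= k -> L1 T (w^~ k)
    & {ae leb R, forall t : R, t \in `[0, T] -> w t 0 = 0}].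

Definition t_integrable_modulus (R : realType) (T : R) (w : R -> R -> R)
    : Prop :=
  t_measurable_modulus T w /\
  \int[leb R]_(t in `]0, T[) w t d @[d --> 0^'+] --> (0 : R).

Definition measurable_continuous (R : realType) (T : R) (H : R -> R -> R -> R)
    : Prop :=
  (forall x p, Lmeasurable `[0, T] (fun t => H t x p)) /\
  (forall t : R, t \in `[0, T] -> continuous (fun z : R * R => H t z.1 z.2)).

Definition x_regular (R : realType) (T : R) (H : R -> R -> R -> R) : Prop :=
  forall r : R, 0 < r -> exists (c : R) (w : R -> R -> R),
    [/\ 0 < c, t_measurable_modulus T w
      & forall t x y p : R, t \in `[0, T] -> `|x| <= r -> `|y| <= r ->
        `|H t x p - H t y p| <= c * `|x - y| * `|p| + w t `|x - y|].

Definition p_lipschitz (R : realType) (T : R) (H : R -> R -> R -> R) : Prop :=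
  exists2 c : R, 0 < c &
    forall t x p q : R, t \in `[0, T] -> `|H t x p - H t x q| <= c * `|p - q|.

Definition p_convex (R : realType) (T : R) (H : R -> R -> R -> R) : Prop :=
  forall t x : R, t \in `[0, T] ->
    convex_function [set: convex_lmodType R^o] (H t x).

Definition p_coercive (R : realType) (T : R) (H : R -> R -> R -> R) : Prop :=
  forall K : R, exists M : R,
    forall t x p : R, t \in `[0, T] -> M <= `|p| -> K <= H t x p.

Definition t_regular (R : realType) (T : R) (H1 H2 : R -> R -> R -> R)
    : Prop :=
  forall Q : set (R * R), compact Q -> exists (h : R -> R) (w : R -> R -> R),
    [/\ Linfty T h, t_integrable_modulus T w
      & forall H, H = H1 \/ H = H2 -> forall t s x y p q : R,
        t \in `[0, T] -> s \in `[0, T] -> Q (x, p) -> Q (y, q) ->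
        `|H t x p - H s y q| <= `|h s - h t|
          + w t (`|x - y| + `|p - q|) + w s (`|x - y| + `|p - q|)].

(* Under continuity and coercivity in p the infimum is attained. *)
Definition pmin (R : realType) (H : R -> R -> R -> R) (t x : R) : R :=
  inf (range (H t x)).

Definition is_argmin (R : realType) (T : R) (H : R -> R -> R -> R)
    (phat : R -> R -> R) : Prop :=
  forall t x p : R, t \in `[0, T] -> H t x (phat t x) <= H t x p.

Definition Hplus (R : realType) (H : R -> R -> R -> R) (phat : R -> R -> R)
    (t x p : R) : R :=
  if p <= phat t x then pmin H t x else H t x p.

Definition Hminus (R : realType) (H : R -> R -> R -> R) (phat : R -> R -> R)
    (t x p : R) : R :=
  if p <= phat t x then H t x p else pmin H t x.

(* Points of the plane are written (x, t). *)
Definition strip (R : realType) (T : R) (Om : set R) : set (R * R) :=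
  Om `*` `]0, T[.

(* Partial derivative in x relative to the domain Om, hence one-sided at an
   endpoint of Om. *)
Definition dxq (R : realType) (Om : set R) (f : R * R -> R) (z : R * R)
    : set_system R :=
  (fun h : R => h^-1 * (f (z.1 + h, z.2) - f z))
    @ within [set h : R | Om (z.1 + h)] 0^'.
Definition dx (R : realType) (Om : set R) (f : R * R -> R) (z : R * R) : R :=
  lim (dxq Om f z).

Definition dt (R : realType) (f : R * R -> R) (z : R * R) : R :=
  derive1 (fun s => f (z.1, s)) z.2.

Definition C1_on (R : realType) (T : R) (Om : set R) (f : R * R -> R) : Prop :=
  let E := strip T Om in
  [/\ {within E, continuous f},
      forall z, E z -> cvg (dxq Om f z),
      forall z, E z -> derivable (fun s => f (z.1, s)) z.2 1,
      {within E, continuous (dx Om f)}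
    & {within E, continuous (dt f)}].

Definition PC1 (R : realType) (T : R) (psi psi1 psi2 : R * R -> R) : Prop :=
  [/\ {within strip T [set: R], continuous psi},
      C1_on T `[0, +oo[ psi1, C1_on T `]-oo, 0] psi2,
      {in strip T `[0, +oo[, psi =1 psi1}
    & {in strip T `]-oo, 0], psi =1 psi2}].

(* In the following three definitions [cmp] is <= for subsolutions and >= for
   supersolutions. *)

(* pt, p1, p2 stand for psi_t(0,t0), psi_x(0^+,t0), psi_x(0^-,t0). *)
Definition junction_condition (R : realType) (cmp : R -> R -> Prop) (T : R)
    (H1 H2 : R -> R -> R -> R) (phat1 phat2 : R -> R -> R) (A b : R -> R)
    (t0 pt p1 p2 : R) : Prop :=
  forall G0 : R * R * R * (R * R) -> R,
    {within `[0, T] `*` `[0, +oo[ `*` `]-oo, 0] `*` [set: R * R],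
      continuous G0} ->
    (exists2 d : R, 0 < d &
      {ae leb R, forall t : R, t \in `[0, T] -> `|t - t0| <= d ->
        forall x1 x2 q1 q2 : R,
          x1 \in `[0, +oo[ -> x2 \in `]-oo, 0] -> `|x1| <= d -> `|x2| <= d ->
          `|q1 - p1| <= d -> `|q2 - p2| <= d ->
          cmp (- b t + G0 (t, x1, x2, (q1, q2)))
              (Num.max (A t) (Num.max (Hminus H1 phat1 t x1 q1)
                                      (Hplus H2 phat2 t x2 q2)))}) ->
    cmp (pt + G0 (t0, 0, 0, (p1, p2))) 0.

(* pt, p0 stand for psi_t(x0,t0), psi_x(x0,t0). *)
Definition interior_condition (R : realType) (cmp : R -> R -> Prop) (T : R)
    (Om : set R) (H : R -> R -> R -> R) (b : R -> R)
    (x0 t0 pt p0 : R) : Prop :=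
  forall G : R * R * R -> R,
    {within `[0, T] `*` Om `*` [set: R], continuous G} ->
    (exists2 d : R, 0 < d &
      {ae leb R, forall t : R, t \in `[0, T] -> `|t - t0| <= d ->
        forall x p : R, Om x -> `|x - x0| <= d -> `|p - p0| <= d ->
          cmp (- b t + G (t, x, p)) (H t x p)}) ->
    cmp (pt + G (t0, x0, p0)) 0.

Definition FLtm_solution (R : realType) (cmp : R -> R -> Prop) (T : R)
    (H1 H2 : R -> R -> R -> R) (phat1 phat2 : R -> R -> R) (A : R -> R)
    (u : R * R -> R) : Prop :=
  let E := strip T [set: R] in
  [/\ {within E, continuous u}, [bounded u z | z in E]
    & forall (b : R -> R) (psi psi1 psi2 : R * R -> R) (x0 t0 : R),
      L1 T b -> PC1 T psi psi1 psi2 -> E (x0, t0) ->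
      let w z := u z - (\int[leb R]_(s in `]0, z.2[) b s + psi z) in
      (\forall z \near (x0, t0), E z -> cmp (w z) (w (x0, t0))) ->
      [/\ x0 = 0 ->
            junction_condition cmp T H1 H2 phat1 phat2 A b t0
              (dt psi1 (0, t0))
              (dx `[0, +oo[ psi1 (0, t0)) (dx `]-oo, 0] psi2 (0, t0)),
          0 < x0 ->
            interior_condition cmp T `]0, +oo[ H1 b x0 t0
              (dt psi (x0, t0)) (derive1 (fun x => psi (x, t0)) x0)
        & x0 < 0 ->
            interior_condition cmp T `]-oo, 0[ H2 b x0 t0
              (dt psi (x0, t0)) (derive1 (fun x => psi (x, t0)) x0)]].

Definition FLtm_subsolution (R : realType) (T : R)
    (H1 H2 : R -> R -> R -> R) (phat1 phat2 : R -> R -> R) (A : R -> R)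
    (u : R * R -> R) : Prop :=
  FLtm_solution (fun a c => a <= c) T H1 H2 phat1 phat2 A u.

Definition FLtm_supersolution (R : realType) (T : R)
    (H1 H2 : R -> R -> R -> R) (phat1 phat2 : R -> R -> R) (A : R -> R)
    (u : R * R -> R) : Prop :=
  FLtm_solution (fun a c => a >= c) T H1 H2 phat1 phat2 A u.

Definition x_locally_lipschitz (R : realType) (T : R) (u : R * R -> R)
    : Prop :=
  forall r : R, 0 < r -> exists L : R, forall t : R, t \in `[0, T[ ->
    L.-lipschitz_[set x : R | `|x| <= r] (fun x => u (x, t)).

(* Main.v *)
Require Import Defs.
From mathcomp Require Import measurable_realfun ring lra unstable.

(** Why the comparison principle holds.

No doubling of variables is used.  Convexity in p allows one to smooth the
subsolution u into an admissible test function, up to an error that depends on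
time only, and such an error is exactly what the L^1 part b of the test
functions can absorb.  The supersolution v is then tested against the smoothed
subsolution.

- Convexity turns H into a supremum of affine functions of p.  For a fixed time
  and place, a subgradient a of H at a slope p0 gives, for all nearby (s, y), a
  bound a p - b(s) <= H(s, y, p) with b in L^1: for (x, p) in a compact set, H
  changes in time by at most |h(s) - h(t)|.  So u is a subsolution of a
  transport equation u_t + a u_x <= b, and u - int b does not increase along
  the lines x' = a ([le_along_transport]).  At the junction, a test function
  with a steep kink shows that u(0, .) + int A does not increase
  ([le_along_junction]).

- Both inequalities are preserved by averaging.  Let k be an L^1 function of
  small integral that dominates |h - g| and |A - g'| for continuous g, g', and
  the modulus ([exists_time_modulus]).  On each half-line, w = u - int k is
  averaged over [x, x + e] with e pointing into the half-line, then over
  [t, t + d].  The resulting psi is C^1 up to the junction and satisfies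
  psi_t + H(t, x, psi_x) <= k(t) + small, for every t
  ([smooth_interior_subsolution]), and at the junction
  psi_t + A(t) <= k(t) + small ([smooth_junction_subsolution]).  The two
  averages disagree at x = 0; adding a function of time alone repairs this, and
  it costs only O(e / d) in psi_t because the time scale d is fixed before e.

- Were u > v somewhere, then psi - int k - v, lowered by a small linear growth
  in x and in t and by a barrier that forbids the final time, would have an
  interior maximum ([box_max]).  There v is touched from below by
  int (-k) + (psi - penalties).  Since H is Lipschitz in p, the continuous
  function G = - psi_t + c |p - psi_x| + small satisfies k + G >= H near the
  point, so the supersolution condition applies and contradicts the strictness
  given by the linear penalty in t ([no_touching_inside]).  At the junction the
  same works with a maximum of three such functions, because H_1^- <= H_1 and
  H_2^+ <= H_2 ([no_touching_at_junction]). *)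

Set Implicit Arguments.
Unset Strict Implicit.
Unset Printing Implicit Defensive.

Local Open Scope classical_set_scope.
Local Open Scope ring_scope.

(** * Approximation in L^1 by a linear class of functions *)

Section L1_closure.
Import HBSimple.
Context d (X : measurableType d) (R : realType) (mu : {measure set X -> \bar R}).
Context (D : set X) (mD : measurable D) (N : set (X -> R)).
Context (N_meas : forall g, N g -> measurable_fun D g).
Context (N_add : forall g h, N g -> N h -> N (fun x => g x + h x)).
Context (N_scale : forall r g, N g -> N (fun x => r * g x)).
Implicit Types f g h : X -> R.

(** Measurability is included so that the class can be shown stable under the
    linear operations, hence to contain all simple functions. *)
Definition L1adherent f := measurable_fun D f /\
  forall e : R, 0 < e -> exists2 g, N g &
  (\int[mu]_(x in D) `|f x - g x|%:E < e%:E)%E.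

Lemma measurable_dist f g : measurable_fun D f -> measurable_fun D g ->
  measurable_fun D (fun x => `|f x - g x|%:E).
Proof.
move=> mf mg; apply/measurable_EFinP; apply: measurableT_comp => //.
exact: measurable_funB.
Qed.

Lemma integral_dist_triangle f g h :
  measurable_fun D f -> measurable_fun D g -> measurable_fun D h ->
  (\int[mu]_(x in D) `|f x - h x|%:E <= \int[mu]_(x in D) `|f x - g x|%:E +
     \int[mu]_(x in D) `|g x - h x|%:E)%E.
Proof.
move=> mf mg mh.
have m1 := measurable_dist mf mg; have m2 := measurable_dist mg mh.
rewrite -ge0_integralD//; apply: ge0_le_integral => //.
- exact: measurable_dist.
- exact: emeasurable_funD.
- by move=> x Dx; rewrite -EFinD lee_fin ler_distD.
Qed.

Lemma L1adherentD f g : L1adherent f -> L1adherent g -> L1adherent (fun x => f x + g x).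
Proof.
move=> [mf af] [mg ag]; split; first exact: measurable_funD.
move=> e e0; have e20 : 0 < e / 2 by rewrite divr_gt0.
have [f' Nf' Hf] := af _ e20; have [g' Ng' Hg] := ag _ e20.
exists (fun x => f' x + g' x); first exact: N_add.
have mf' := N_meas Nf'; have mg' := N_meas Ng'.
apply: (@le_lt_trans _ _ (\int[mu]_(x in D) `|f x - f' x|%:E +
     \int[mu]_(x in D) `|g x - g' x|%:E)%E); last first.
  by rewrite (splitr e) EFinD lteD.
have m1 := measurable_dist mf mf'; have m2 := measurable_dist mg mg'.
rewrite -ge0_integralD//; apply: ge0_le_integral => //.
- by apply: measurable_dist; exact: measurable_funD.
- exact: emeasurable_funD.
- by move=> x Dx; rewrite -EFinD lee_fin opprD addrACA ler_normD.
Qed.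

Lemma L1adherentZ r f : L1adherent f -> L1adherent (fun x => r * f x).
Proof.
move=> [mf af]; split; first exact: measurable_funM.
move=> e e0; have r0 : 0 < `|r| + 1 by rewrite ltr_wpDl.
have [f' Nf' Hf] := af _ (divr_gt0 e0 r0).
exists (fun x => r * f' x); first exact: N_scale.
have mf' := N_meas Nf'; have m1 := measurable_dist mf mf'.
apply: (@le_lt_trans _ _ ((`|r| + 1)%:E * \int[mu]_(x in D) `|f x - f' x|%:E)%E).
  rewrite -ge0_integralZl//; try (by rewrite lee_fin ltW).
  apply: ge0_le_integral => //.
  + by apply: measurable_dist; exact: measurable_funM.
  + exact: measurable_funeM.
  + move=> x Dx; rewrite -EFinM lee_fin -mulrBr normrM.
    by rewrite ler_wpM2r// lerDl.
by rewrite muleC -lte_pdivlMr// EFinM in Hf *.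
Qed.

Lemma L1adherent_sfun (f : {sfun X >-> R}) :
  (forall A, measurable A -> L1adherent (\1_A)) -> L1adherent f.
Proof.
move=> H1.
rewrite (_ : (f : X -> R) = fun x => \sum_(y <- finmap.enum_fset (fset_set (range f))) y * \1_(f @^-1` [set y]) x); last first.
  by apply/funext => x; rewrite fimfunE fsbig_finite.
elim: (finmap.enum_fset _) => [|y s IH].
  have -> : (fun x : X => \sum_(y <- [::]) y * \1_(f @^-1` [set y]) x) = fun x => 0 * (\1_set0 x).
    by apply/funext => x; rewrite big_nil mul0r.
  by apply: L1adherentZ; exact: H1.
have -> : (fun x : X => \sum_(z <- y :: s) z * \1_(f @^-1` [set z]) x) =
   fun x => y * \1_(f @^-1` [set y]) x + \sum_(z <- s) z * \1_(f @^-1` [set z]) x.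
  by apply/funext => x; rewrite big_cons.
by apply: L1adherentD => //; apply: L1adherentZ; exact: H1.
Qed.

(** Simple functions are linear combinations of indicators and are dense in
    L^1, so only indicators have to be approximated. *)
Lemma L1adherent_integrable f : (forall A, measurable A -> L1adherent (\1_A)) ->
  mu.-integrable D (EFin \o f) -> L1adherent f.
Proof.
move=> H1 fi.
have mf : measurable_fun D f by case/integrableP : fi => /measurable_EFinP.
split => // e e0.
have [g_ [gi _ gcv]] := approximation_sfun_integrable mD fi.
have e20 : 0 < e / 2 by rewrite divr_gt0.
have [n gn] : exists n, (\int[mu]_(z in D) `|f z - g_ n z|%:E < (e/2)%:E)%E.
  have [//|n _ Hn] := gcv [set y | (y < (e/2)%:E)%E].
    by apply: open_ereal_lt'; rewrite lte_fin.
  by exists n; exact: (Hn n (leqnn n)).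
have [mg ag] := L1adherent_sfun (g_ n) H1.
have [g Ng Hg] := ag _ e20.
exists g => //.
apply: (le_lt_trans (integral_dist_triangle (g := g_ n) mf mg (N_meas Ng))).
by rewrite (splitr e) EFinD lteD.
Qed.

End L1_closure.

(** * Real-valued integrable functions *)

Section integrable_real.
Context d (X : measurableType d) (R : realType) (mu : {measure set X -> \bar R}).
Context (D : set X) (mD : measurable D).
Implicit Types f g : X -> R.

Lemma integrable_realD f g : mu.-integrable D (EFin \o f) ->
  mu.-integrable D (EFin \o g) -> mu.-integrable D (EFin \o (fun x => f x + g x)).
Proof.
move=> fi gi; have := integrableD mD fi gi.
by apply: eq_integrable => // x _ /=; rewrite EFinD.
Qed.

Lemma integrable_realN f : mu.-integrable D (EFin \o f) ->
  mu.-integrable D (EFin \o (fun x => - f x)).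
Proof.
move=> fi; have := integrableN fi.
by apply: eq_integrable => // x _ /=; rewrite EFinN.
Qed.

Lemma integrable_real_norm f : mu.-integrable D (EFin \o f) ->
  mu.-integrable D (EFin \o (fun x => `|f x|)).
Proof. exact: integrable_norm. Qed.

Lemma RintegralN f : mu.-integrable D (EFin \o f) ->
  \int[mu]_(x in D) (- f x) = - \int[mu]_(x in D) f x.
Proof.
move=> fi; have := RintegralZl (-1) mD fi.
by rewrite mulN1r => <-; apply: eq_Rintegral => x _; rewrite mulN1r.
Qed.

Lemma ae_bounded_integrable f (M : R) : (mu D < +oo)%E -> measurable_fun D f ->
  {ae mu, forall x, D x -> `|f x| <= M} -> mu.-integrable D (EFin \o f).
Proof.
move=> muD mf bf; apply/integrableP; split; first exact/measurable_EFinP.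
apply: (@le_lt_trans _ _ (\int[mu]_(x in D) (`|M|%:E))%E); last first.
  by rewrite integral_cst// lte_mul_pinfty// lee_fin.
apply: ae_ge0_le_integral => //.
- by apply: measurableT_comp => //; exact/measurable_EFinP.
- apply: filterS bf => x H Dx /=.
  by rewrite lee_fin (le_trans (H Dx))// ler_norm.
Qed.

(** The uniform smallness of the integral over small sets is available for
    functions integrable on the whole space; extension by zero transfers it to
    D. *)
Lemma integral_restrict_continuous f (e : R) : mu.-integrable D (EFin \o f) -> 0 < e ->
  exists2 d0 : R, 0 < d0 & forall A, measurable A -> A `<=` D -> (mu A < d0%:E)%E ->
  `|\int[mu]_(x in A) f x| <= e.
Proof.
move=> fi e0.
have fi' : mu.-integrable setT (EFin \o (f \_ D)).
  have := fi; rewrite (integrable_mkcond _ mD).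
  by rewrite restrict_EFin.
have [d0 [d00 Hd]] := integral_normr_continuous fi' e0.
exists d0 => // A mA AD muA.
apply: (le_trans (le_normr_Rintegral mA _)).
  exact: integrableS fi.
have -> : \int[mu]_(r in A) `|f r| = \int[mu]_(r in A) `|(f \_ D) r|.
  by apply: eq_Rintegral => x; rewrite inE => /AD xI; rewrite patchE mem_set.
by apply: ltW; apply: Hd.
Qed.

End integrable_real.

(** * The completed Lebesgue measure on an interval *)

Section lebesgue_tools.
Context {R : realType}.
Implicit Types (T : R) (f g h b : R -> R).

Lemma measurable_itv_leb (i : interval R) : measurable ([set` i] : set (lebType R)).
Proof. by apply: sub_caratheodory; exact: measurable_itv. Qed.

(** The identity from the completed to the Borel line is measurable, and it
    pushes the completed measure to Lebesgue measure; Borel facts are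
    transferred through it. *)
Lemma measurable_id_leb :
  measurable_fun [set: lebType R] (fun x => (x : R) : measurableTypeR R).
Proof. by move=> _ Y mY; rewrite setTI; exact: sub_caratheodory. Qed.

Lemma measurable_fun_leb d (Y : measurableType d) (f : measurableTypeR R -> Y)
    (D : set (lebType R)) :
  measurable_fun setT f -> measurable_fun D (f : lebType R -> Y).
Proof.
move=> mf; apply: (@measurable_funS _ _ _ _ setT) => //.
exact: (measurableT_comp mf measurable_id_leb).
Qed.

Lemma continuous_measurable_leb (D : set (lebType R)) g :
  continuous g -> measurable_fun D (g : lebType R -> R).
Proof. by move=> cg; apply: measurable_fun_leb; exact: continuous_measurable_fun. Qed.

Lemma ge0_integral_leb (D : set R) (f : measurableTypeR R -> \bar R) :
  @measurable _ (measurableTypeR R) D ->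
  measurable_fun setT f -> (forall x, 0 <= f x)%E ->
  (\int[leb R]_(x in D) f x = \int[lebesgue_measure]_(x in D) f x)%E.
Proof.
move=> mD mf f0.
symmetry.
transitivity (\int[pushforward (leb R) (fun x : lebType R => x : measurableTypeR R)]_(x in D) f x)%E => //.
rewrite (@ge0_integral_pushforward _ _ (lebType R) (measurableTypeR R) R
  (fun x => x) measurable_id_leb (leb R)) //.
exact: measurable_funTS.
Qed.

(** A set of the completed sigma-algebra is a Borel set up to a null set, so
    its indicator may be replaced by a Borel one, for which density of
    continuous functions is known. *)
Lemma L1adherent_indic T (A : set (lebType R)) : 0 < T -> measurable A ->
  L1adherent (leb R) `]0, T[ [set g : R -> R | continuous g] (\1_A).
Proof.
move=> T0 mA; split; first exact: measurable_indic.
move=> e e0.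
have : completed_algebra_gen (@lebesgue_measure R) A.
  by rewrite -g_sigma_completed_algebra_genE completed_caratheodory_measurable.
case=> X mX [N negN XN].
have mI : @measurable _ (measurableTypeR R) `]0, T[ by exact: measurable_itv.
have finI : (lebesgue_measure (`]0%R, T[%classic : set R) < +oo)%E.
  by rewrite lebesgue_measure_itv/= lte_fin T0 ltry.
have mX1 : measurable_fun setT (\1_X : measurableTypeR R -> R).
  exact: measurable_indic.
have [g_ [gc gi gcv]] : exists g_ : (R -> R)^nat,
    [/\ forall n, continuous (g_ n),
        forall n, lebesgue_measure.-integrable `]0, T[ (EFin \o g_ n) &
        (\int[lebesgue_measure]_(z in `]0%R, T[) `|((\1_X : R -> R) z - g_ n z)%:E|)%E @[n --> \oo] --> 0%E].
  apply: approximation_continuous_integrable => //.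
  apply: measurable_bounded_integrable => //.
  exists 1; split; rewrite ?num_real// => M M1 x _ /=.
  by rewrite ger0_norm// (le_trans _ (ltW M1))// indicE lern1 leq_b1.
have [n gn] : exists n, (\int[lebesgue_measure]_(z in `]0%R, T[) `|((\1_X : R -> R) z - g_ n z)%:E| < e%:E)%E.
  have [//|n _ Hn] := gcv [set y | (y < e%:E)%E].
    by apply: open_ereal_lt'; rewrite lte_fin.
  by exists n; exact: (Hn n (leqnn n)).
exists (g_ n) => //; apply: le_lt_trans gn.
have mg : measurable_fun setT (g_ n : measurableTypeR R -> R).
  exact: continuous_measurable_fun.
have m1 : measurable_fun (`]0, T[ : set (lebType R)) (fun x => `|(\1_A : R -> R) x - g_ n x|%:E).
  apply: measurable_dist; first exact: measurable_indic.
  exact: continuous_measurable_leb.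
have m2 : measurable_fun (`]0, T[ : set (lebType R)) (fun x => `|(\1_X : R -> R) x - g_ n x|%:E).
  apply: measurable_dist; first exact: measurable_fun_leb.
  exact: continuous_measurable_leb.
rewrite -ge0_integral_leb; first last.
- by move=> x; rewrite lee_fin.
- by apply: measurable_dist.
- exact: mI.
rewrite le_eqVlt; apply/orP; left; apply/eqP.
apply: (ge0_ae_eq_integral (measurable_itv_leb _) m1 m2).
- by move=> x _; rewrite lee_fin.
- by move=> x _; rewrite lee_fin.
- case: negN => N' [mN' N'0 NN'].
  exists N'; split => //; first exact: sub_caratheodory.
  move=> x /= /not_implyP[_ H]; apply: NN'; apply: contrapT => nNx; apply: H.
  congr (`|_ - _|%:E); rewrite !indicE; congr (_%:R).
  have -> // : (x \in A) = (x \in X).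
  apply/idP/idP; rewrite !inE -XN; first by case.
  by left.
Qed.

Lemma L1_dense T f e : 0 < T -> L1 T f -> 0 < e ->
  exists2 g, continuous g & \int[leb R]_(x in `]0, T[) `|f x - g x| < e.
Proof.
move=> T0 fi e0.
have [||||mf af] := @L1adherent_integrable _ (lebType R) R (leb R) `]0, T[
  (measurable_itv_leb _) [set g : R -> R | continuous g] _ _ _ f _ fi.
- by move=> g cg; exact: continuous_measurable_leb.
- by move=> g h cg ch x; apply: cvgD; [exact: cg|exact: ch].
- by move=> r g cg x; apply: cvgM; [exact: cvg_cst|exact: cg].
- by move=> A mA; exact: L1adherent_indic.
have [g cg H] := af _ e0.
exists g => //.
rewrite /Rintegral -lte_fin fineK// ge0_fin_numE; first exact: lt_trans H (ltry _).
by apply: integral_ge0 => x _; rewrite lee_fin.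
Qed.

Lemma fin_leb_itv (s t : R) : (leb R (`]s, t[%classic : set R) < +oo)%E.
Proof.
change (lebesgue_measure (`]s, t[%classic : set R) < +oo)%E.
by rewrite lebesgue_measure_itv/=; case: ifP => _; rewrite ltry.
Qed.

Lemma L1_cst T (r : R) : L1 T (fun=> r).
Proof.
apply: measurable_bounded_integrable.
- exact: measurable_itv_leb.
- exact: fin_leb_itv.
- exact: measurable_cst.
- by exists `|r|; split; rewrite ?num_real// => M rM x _ /=; exact: ltW.
Qed.

Lemma L1D T f g : L1 T f -> L1 T g -> L1 T (fun s => f s + g s).
Proof. exact: (integrable_realD (measurable_itv_leb _)). Qed.

Lemma L1N T f : L1 T f -> L1 T (fun s => - f s).
Proof. exact: (integrable_realN (measurable_itv_leb _)). Qed.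

Lemma L1_norm T f : L1 T f -> L1 T (fun s => `|f s|).
Proof. exact: integrable_real_norm. Qed.

Lemma L1_continuous T g : continuous g -> L1 T g.
Proof.
move=> cg; apply: measurable_bounded_integrable.
- exact: measurable_itv_leb.
- exact: fin_leb_itv.
- exact: continuous_measurable_leb.
- have : bounded_set (g @` `[0, T]).
    apply: compact_bounded; apply: continuous_compact; last exact: segment_compact.
    exact: continuous_subspaceT.
  case=> M [Mr HM]; exists M; split => // x Mx y /= yI.
  apply: (HM _ Mx); exists y => //=.
  by move: yI; rewrite !in_itv/= => /andP[/ltW -> /ltW ->].
Qed.

Lemma Linfty_L1 T f : Linfty T f -> L1 T f.
Proof.
move=> [mf [M bM]].
exact: (ae_bounded_integrable (M := M) (measurable_itv_leb _) (fin_leb_itv _ _) mf bM).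
Qed.

Lemma L1_sub T f (s t : R) : 0 <= s -> t <= T -> L1 T f ->
  (leb R).-integrable `]s, t[ (EFin \o f).
Proof.
move=> s0 tT; apply: integrableS => //; try exact: measurable_itv_leb.
by move=> x /=; rewrite !in_itv/= => /andP[a b]; rewrite (le_lt_trans s0)//= (lt_le_trans b).
Qed.

Lemma Rint_cst (r t : R) : 0 <= t -> \int[leb R]_(s in `]0, t[) r = r * t.
Proof.
move=> t0; rewrite Rintegral_cst; last exact: measurable_itv_leb.
congr (_ * _).
change (fine (lebesgue_measure (`]0%R, t[%classic : set R)) = t).
rewrite lebesgue_measure_itv/= lte_fin; case: ltP => /= h; first by rewrite subr0.
by apply/eqP; rewrite eq_le t0 h.
Qed.

Lemma Rint_addc T f (r t : R) : 0 <= t -> t <= T -> L1 T f ->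
  \int[leb R]_(s in `]0, t[) (f s + r) = \int[leb R]_(s in `]0, t[) f s + r * t.
Proof.
move=> t0 tT fi; rewrite RintegralD.
- by rewrite Rint_cst.
- exact: measurable_itv_leb.
- exact: L1_sub fi.
- exact: (L1_sub _ tT (L1_cst T r)).
Qed.

Lemma Rint_opp T f (t : R) : t <= T -> L1 T f ->
  \int[leb R]_(s in `]0, t[) (- f s) = - \int[leb R]_(s in `]0, t[) f s.
Proof.
by move=> tT fi; exact: (RintegralN (measurable_itv_leb _) (L1_sub (lexx 0) tT fi)).
Qed.

(** The difference is integrated over a set difference rather than over an
    interval, so that no distinction is needed at the endpoint 0. *)
Lemma Rint_split T f (s t : R) : 0 <= s -> s <= t -> t <= T -> L1 T f ->
  \int[leb R]_(r in `]0, t[) f r = \int[leb R]_(r in `]0, s[) f r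
     + \int[leb R]_(r in `]0, t[ `\` `]0, s[) f r.
Proof.
move=> s0 st tT fi.
have E : `]0, t[%classic = `]0, s[ `|` (`]0, t[ `\` `]0, s[)%classic :> set R.
  apply/seteqP; split => x.
    by move=> xt; have [xs|xs] := pselect ((`]0, s[%classic : set R) x); [left|right].
  case=> [|[]//] /=; rewrite !in_itv/= => /andP[-> xs] /=; exact: lt_le_trans xs st.
rewrite {1}E Rintegral_setU//.
- exact: measurable_itv_leb.
- by apply: measurableD; exact: measurable_itv_leb.
- by rewrite -E; exact: (L1_sub (lexx 0) tT fi).
- by apply/disj_setPS => x [? []].
Qed.

Lemma Rint_le T f (s t : R) : 0 <= s -> s <= t -> t <= T -> L1 T f ->
  (forall r, 0 < r -> s <= r -> r < t -> 0 <= f r) ->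
  \int[leb R]_(r in `]0, s[) f r <= \int[leb R]_(r in `]0, t[) f r.
Proof.
move=> s0 st tT fi f0; rewrite (Rint_split s0 st tT fi) lerDl.
apply: Rintegral_ge0 => x [/=]; rewrite !in_itv/= => /andP[x0 xt] /negP.
by rewrite x0 -leNgt => sx; exact: f0.
Qed.

Lemma Rint_add T f g (t : R) : t <= T -> L1 T f -> L1 T g ->
  \int[leb R]_(s in `]0, t[) (f s + g s) =
  \int[leb R]_(s in `]0, t[) f s + \int[leb R]_(s in `]0, t[) g s.
Proof.
move=> tT fi gi.
exact: (RintegralD (measurable_itv_leb _) (L1_sub (lexx 0) tT fi) (L1_sub (lexx 0) tT gi)).
Qed.

(** This is the continuity in t of the term int_0^t b of the test functions. *)
Lemma Rint_unif_continuous T f (e : R) : L1 T f -> 0 < e ->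
  exists2 d : R, 0 < d & forall s t, 0 <= s -> s <= t -> t <= T -> t - s < d ->
  `|\int[leb R]_(r in `]0, t[) f r - \int[leb R]_(r in `]0, s[) f r| <= e.
Proof.
move=> fi e0.
have [d d0 Hd] := integral_restrict_continuous (measurable_itv_leb _) fi e0.
exists d => // s t s0 st tT std.
have mB : measurable (`]0, t[ `\` `]0, s[ : set (lebType R)).
  by apply: measurableD; exact: measurable_itv_leb.
rewrite (Rint_split s0 st tT fi) addrAC subrr add0r.
apply: Hd => //.
  by move=> x [/= xt _]; move: xt; rewrite !in_itv/= => /andP[-> xt] /=; exact: lt_le_trans xt _.
apply: (@le_lt_trans _ _ (leb R (`[s, t] : set R))).
  apply: le_measure; rewrite ?inE//; first exact: measurable_itv_leb.
  move=> x [/= xt xs]; move: xt xs; rewrite !in_itv/= => /andP[x0 xt] /negP.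
  by rewrite x0/= -leNgt => -> /=; exact: ltW.
change (lebesgue_measure (`[s, t]%classic : set R) < d%:E)%E.
rewrite lebesgue_measure_itv/=; case: ifP => _; rewrite -?EFinB lte_fin//.
Qed.

End lebesgue_tools.

(** * Primitives of continuous functions *)

Section primitives.
Context {R : realType}.
Implicit Types (f g F G : R -> R) (x t e : R).

Lemma continuous_integrable_itv f (a b : R) : continuous f ->
  (@lebesgue_measure R).-integrable `[a, b] (EFin \o f).
Proof.
move=> cf; apply: continuous_compact_integrable; first exact: segment_compact.
exact: continuous_subspaceT.
Qed.

(** The integral from a fixed base point a is a primitive only to the right of
    a. Moving the base point changes it by a constant, so the differences
    between x and 0 agree for all base points and glue to a primitive on the
    whole line. *)
Lemma exists_primitive f : continuous f ->
  exists F, (forall x, is_derive x (1 : R) F (f x)) /\ F 0 = 0.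
Proof.
move=> cf.
pose G (a x : R) : R := \int[lebesgue_measure]_(t in `[a, x]) f t.
have dG a x : a < x -> is_derive x (1 : R) (G a) (f x).
  move=> ax; have [||||H1 H2] := @continuous_FTC1_closed R f a x (x + 1).
  - by rewrite ltrDl.
  - exact: continuous_integrable_itv.
  - exact: ax.
  - exact: cf.
  by apply: DeriveDef => //; rewrite -derive1E.
have GB a b x : a <= b -> b <= x -> G a x = G a b + G b x.
  move=> ab bx; rewrite /G -(@Rintegral_itv_obnd_cbnd _ b).
  - rewrite -(@Rintegral_itvB _ f (BLeft a) (BRight x) b).
    + by rewrite addrC subrK.
    + exact: continuous_integrable_itv.
    + by rewrite bnd_simp.
    + by rewrite bnd_simp.
  - apply: (integrableS _ _ _ (@continuous_integrable_itv f b x cf)) => //.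
    by apply: subset_itvr; rewrite bnd_simp.
(* The base point - |x| - 1 lies below both x and 0. *)
pose F x := G (- `|x| - 1) x - G (- `|x| - 1) 0.
exists F; split; last by rewrite /F subrr.
move=> x0.
have : is_derive x0 (1 : R) (fun x => G (- `|x0| - 2) x - G (- `|x0| - 2) 0) (f x0).
  rewrite -[f x0]subr0; apply: (is_deriveB (dG _ _ _) (is_derive_cst _ _ _)).
  by have := ler_norm (- x0); rewrite normrN; lra.
apply: near_eq_is_derive.
near=> x.
have xx0 : `|x - x0| < 1 by near: x; exact: (@cvgr_distC_lt _ _ _ _ _ id).
have n1 : `|x| <= `|x0| + 1.
  by rewrite -(subrK x0 x) addrC (le_trans (ler_normD _ _))// lerD2l ltW.
have n2 : - `|x| <= x by rewrite lerNl (le_trans (ler_norm _))// normrN.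
have n3 := normr_ge0 x.
rewrite /F (@GB (- `|x0| - 2) (- `|x| - 1) x) ?(@GB (- `|x0| - 2) (- `|x| - 1) 0); lra.
Unshelve. all: by end_near. Qed.

(** The primitive that vanishes at 0. All later estimates on integrals of
    continuous functions go through the mean value theorem for it, which
    avoids changes of variables and Fubini. *)
Definition primitive f : R -> R :=
  get [set F : R -> R | (forall x, is_derive x (1 : R) F (f x)) /\ F 0 = 0].

Lemma primitiveP f : continuous f ->
  (forall x, is_derive x (1 : R) (primitive f) (f x)) /\ primitive f 0 = 0.
Proof. by move=> /exists_primitive[F HF]; exact: (@getPex _ (fun F : R -> R => (forall x, is_derive x (1 : R) F (f x)) /\ F 0 = 0) (ex_intro _ F HF)). Qed.

Lemma is_derive_continuous F f :
  (forall x, is_derive x (1 : R) F (f x)) -> continuous F.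
Proof.
by move=> H x; have [h _] := H x; exact/differentiable_continuous/derivable1_diffP.
Qed.

(** No order is imposed on a and b, because the averages in space are taken
    over steps of either sign. *)
Lemma mean_value F f (a b : R) : (forall x, is_derive x (1 : R) F (f x)) ->
  exists2 c, Num.min a b <= c <= Num.max a b & F b - F a = f c * (b - a).
Proof.
move=> H; have cF := is_derive_continuous H.
have [ab|ba] := leP a b.
  have [c cab E] := MVT_segment ab (fun x _ => H x) (continuous_subspaceT cF).
  by exists c => //; move: cab; rewrite in_itv.
have [c cab E] := MVT_segment (ltW ba) (fun x _ => H x) (continuous_subspaceT cF).
exists c; first by move: cab; rewrite in_itv.
by rewrite -opprB E; ring.
Qed.

Lemma is_derive_shift F f (h : R) x : (forall y, is_derive y (1 : R) F (f y)) ->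
  is_derive x (1 : R) (fun y => F (y + h)) (f (x + h)).
Proof.
move=> H; rewrite -[f (x + h)]mulr1.
have := @is_derive1_comp R F (fun y => y + h) x (f (x+h)) 1 (H _).
apply; rewrite -[X in is_derive _ _ _ X]addr0.
exact: (is_deriveD (is_derive_id _ _) (is_derive_cst _ _ _)).
Qed.

End primitives.

(** * Continuous functions on the plane *)

Section plane.
Context {R : realType}.
Implicit Types (f g : R -> R) (w : R * R -> R) (z : R * R) (x t e d : R).

Lemma nbhs2P (P : R * R -> Prop) z :
  (\forall z' \near z, P z') <->
  exists2 d : R, 0 < d & forall z', `|z'.1 - z.1| < d -> `|z'.2 - z.2| < d -> P z'.
Proof.
split.
  move=> /nbhs_ballP[d /= d0 H]; exists d => // z' h1 h2; apply: H.
  by split => /=; rewrite /ball/= distrC.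
move=> [d d0 H]; apply/nbhs_ballP; exists d => //= z' [h1 h2].
by apply: H; rewrite distrC.
Qed.

Lemma continuous2P w : continuous w <-> forall z e, 0 < e -> exists2 d : R, 0 < d &
  forall z', `|z'.1 - z.1| < d -> `|z'.2 - z.2| < d -> `|w z' - w z| < e.
Proof.
split.
  move=> cw z e e0; apply/nbhs2P.
  by move/cvgrPdistC_lt : (cw z) => /(_ e e0).
move=> H z; apply/cvgrPdistC_lt => e e0.
by have := H z e e0 => /nbhs2P.
Qed.

Lemma continuous2_comp (X : topologicalType) (w : R * R -> R) (a b : X -> R) :
  continuous w -> continuous a -> continuous b -> continuous (fun u => w (a u, b u)).
Proof.
move=> cw ca cb u; apply: (@continuous_comp _ _ _ (fun u => (a u, b u)) w).
  by apply: (cvg_pair (ca u) (cb u)).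
exact: cw.
Qed.

Lemma continuous2_fst : continuous (fun z : R * R => z.1).
Proof. by move=> z; exact: cvg_fst. Qed.
Lemma continuous2_snd : continuous (fun z : R * R => z.2).
Proof. by move=> z; exact: cvg_snd. Qed.
Lemma continuous2_l w t : continuous w -> continuous (fun y => w (y, t)).
Proof. move=> cw; apply: continuous2_comp => // y; [exact: cvg_id|exact: cvg_cst]. Qed.
Lemma continuous2_r w x : continuous w -> continuous (fun s => w (x, s)).
Proof. move=> cw; apply: continuous2_comp => // y; [exact: cvg_cst|exact: cvg_id]. Qed.

(** The second point is allowed to leave the box: this is what near-covering
    compactness gives, and it spares a discussion at the boundary. *)
Lemma uniformly_continuous_box w (M e : R) : continuous w -> 0 < e ->
  exists2 d : R, 0 < d & forall z z', `|z.1| <= M -> `|z.2| <= M ->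
  `|z'.1 - z.1| <= d -> `|z'.2 - z.2| <= d -> `|w z' - w z| <= e.
Proof.
move=> cw e0.
have cK : compact (`[- M, M] `*` `[- M, M] : set (R * R)).
  by apply: compact_setX; exact: segment_compact.
pose P (d : R) (z : R * R) := forall z', `|z'.1 - z.1| <= d -> `|z'.2 - z.2| <= d -> `|w z' - w z| <= e.
have : \forall d \near (0 : R)^'+, `[- M, M] `*` `[- M, M] `<=` P d.
  move/compact_near_coveringP : cK; apply => z _.
  have e20 : 0 < e / 2 by rewrite divr_gt0.
  have [r r0 Hr] := (continuous2P w).1 cw z _ e20.
  have r20 : 0 < r / 2 by rewrite divr_gt0.
  near=> z' d => z'' h1 h2.
  have k1 : `|z'.1 - z.1| < r / 2 /\ `|z'.2 - z.2| < r / 2.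
    by near: z'; apply/nbhs2P; exists (r/2).
  have k2 : d < r / 2 by near: d; exact: nbhs_right_lt.
  have -> : w z'' - w z' = (w z'' - w z) - (w z' - w z) by ring.
  have rr : r / 2 < r by lra.
  have A : `|w z'' - w z| < e / 2.
    apply: Hr.
      by rewrite (le_lt_trans (ler_distD z'.1 _ _))// (splitr r) ltrD ?(le_lt_trans h1) ?k1.1.
    by rewrite (le_lt_trans (ler_distD z'.2 _ _))// (splitr r) ltrD ?(le_lt_trans h2) ?k1.2.
  have B : `|w z' - w z| < e / 2 by apply: Hr; apply: lt_trans rr; case: k1.
  by rewrite (le_trans (ler_normB _ _))// (splitr e) lerD// ltW.
move=> [d /= d0 Hd]; exists (d / 2); first by rewrite divr_gt0.
move=> z z' z1 z2; apply: (Hd (d/2)) => /=.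
- by rewrite /ball/= sub0r normrN gtr0_norm ?divr_gt0//; lra.
- by rewrite divr_gt0.
- by split => /=; rewrite in_itv/= -ler_norml.
Unshelve. all: by end_near. Qed.

Lemma primitive_dist f g t e : continuous f -> continuous g ->
  (forall s, `|s| <= `|t| -> `|f s - g s| <= e) ->
  `|primitive f t - primitive g t| <= e * `|t|.
Proof.
move=> /primitiveP[df f0] /primitiveP[dg g0] H.
have dd x : is_derive x (1 : R) (primitive f - primitive g) (f x - g x) by exact: is_deriveB.
have [c cb] := mean_value 0 t dd.
rewrite !fctE f0 g0 !subr0 => ->; rewrite normrM ler_wpM2r// H//.
move: cb; case: (leP 0 t) => t0 /andP[c0 ct].
  by rewrite !ger0_norm.
by rewrite !ler0_norm ?lerN2// ltW.
Qed.

Lemma continuous_primitive2 w : continuous w ->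
  continuous (fun z => primitive (fun s => w (z.1, s)) z.2).
Proof.
move=> cw; apply/continuous2P => z e e0.
have e20 : 0 < e / 2 by rewrite divr_gt0.
pose M := `|z.1| + `|z.2| + 1.
have M0 : 0 < M by rewrite ltr_wpDl// addr_ge0.
have [d1 d10 H1] := uniformly_continuous_box M cw (divr_gt0 e20 M0).
have [dp _] := primitiveP (@continuous2_r w z.1 cw).
have cp := is_derive_continuous dp.
have [d2 /= d20 H2] : exists2 d : R, 0 < d & forall t', `|t' - z.2| < d ->
  `|primitive (fun s => w (z.1, s)) t' - primitive (fun s => w (z.1, s)) z.2| < e / 2.
  move/cvgrPdistC_lt : (cp z.2) => /(_ _ e20) /nbhs_ballP[d d0 Hd].
  by exists d => // t' h; apply: Hd; rewrite /ball/= distrC.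
exists (Num.min 1 (Num.min d1 d2)); first by rewrite !lt_min ltr01 d10.
move=> z'; rewrite !lt_min => /and3P[a1 a2 a3] /and3P[b1 b2 b3].
rewrite (le_lt_trans (ler_distD (primitive (fun s => w (z.1, s)) z'.2) _ _))//.
rewrite (splitr e) ler_ltD// ?H2//.
have z'M : `|z'.2| <= M.
  rewrite -(subrK z.2 z'.2) (le_trans (ler_normD _ _))// /M.
  by have := normr_ge0 z.1; lra.
apply: (@le_trans _ _ (e / 2 / M * `|z'.2|)).
  apply: primitive_dist; [exact: continuous2_r|exact: continuous2_r|] => s sz.
  apply: (H1 (z.1, s) (z'.1, s)) => /=.
  - by rewrite /M; have := normr_ge0 z.2; lra.
  - exact: le_trans sz z'M.
  - exact: ltW.
  - by rewrite subrr normr0 ltW.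
by rewrite -mulrA -[leRHS]mulr1 ler_pM2l// mulrC ler_pdivrMr// mul1r.
Qed.

Lemma continuous_primitive1 w : continuous w ->
  continuous (fun z => primitive (fun y => w (y, z.2)) z.1).
Proof.
move=> cw.
have h : continuous (fun z : R * R => w (z.2, z.1)).
  by apply: continuous2_comp => //; [exact: continuous2_snd|exact: continuous2_fst].
apply: (continuous2_comp (continuous_primitive2 h)); [exact: continuous2_snd|exact: continuous2_fst].
Qed.

Lemma is_derive_dist_le f x l : (forall e, 0 < e -> exists2 d : R, 0 < d &
   forall h, h != 0 -> `|h| < d -> `|h^-1 * (f (x + h) - f x) - l| <= e) ->
  is_derive x (1 : R) f l.
Proof.
move=> H.
have H' : h^-1 *: (f (h *: 1 + x) - f x) @[h --> (0 : R)^'] --> l.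
  apply/cvgrPdistC_le => e e0; have [d d0 Hd] := H e e0.
  apply: (filterS _ (nbhs0_lt d0)) => h hd h0.
  by rewrite [h *: 1]mulr1 (addrC h x); apply: Hd.
apply: DeriveDef; first by apply/cvg_ex; exists l.
exact/cvg_lim.
Qed.

(** Leibniz rule: by the mean value theorem the difference quotient in x,
    minus the expected limit, is the primitive of g1 (xi, s) - g1 (x, s),
    which is uniformly small on the compact set of the relevant s. *)
Lemma is_derive_primitive_param (g g1 : R * R -> R) x t : continuous g -> continuous g1 ->
  (forall z, is_derive z.1 (1 : R) (fun y => g (y, z.2)) (g1 z)) ->
  is_derive x (1 : R) (fun y => primitive (fun s => g (y, s)) t) (primitive (fun s => g1 (x, s)) t).
Proof.
move=> cg cg1 dg; apply: is_derive_dist_le => e e0.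
pose M := `|x| + `|t| + 1.
have M0 : 0 < M by rewrite ltr_wpDl// addr_ge0.
have [d d0 H] := uniformly_continuous_box M cg1 (divr_gt0 e0 M0).
exists d => // h h0 hd.
pose phi := h^-1 *: (primitive (fun s => g (x + h, s)) - primitive (fun s => g (x, s))) - primitive (fun s => g1 (x, s)).
have [d1 p1] := primitiveP (@continuous2_r g (x + h) cg).
have [d2 p2] := primitiveP (@continuous2_r g x cg).
have [d3 p3] := primitiveP (@continuous2_r g1 x cg1).
have dphi s : is_derive s (1 : R) phi (h^-1 * (g (x + h, s) - g (x, s)) - g1 (x, s)).
  exact: (is_deriveB (is_deriveZ _ (is_deriveB (d1 s) (d2 s))) (d3 s)).
have [c cb] := mean_value 0 t dphi.
rewrite /phi !fctE p1 p2 p3 !subr0 [_ *: 0]mulr0 subr0 => E.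
rewrite [X in `|X|]E normrM.
have ct : `|c| <= `|t|.
  move: cb; case: (leP 0 t) => t0 /andP[c0 ct]; first by rewrite !ger0_norm.
  by rewrite !ler0_norm ?lerN2// ltW.
have [y yb Ey] := @mean_value R (fun y => g (y, c)) (fun y => g1 (y, c)) x (x + h) (fun y => dg (y, c)).
rewrite Ey (addrC x h) addrK mulrCA mulVf// mulr1.
apply: (@le_trans _ _ (e / M * `|t|)).
  rewrite ler_wpM2r//; apply: (H (x, c) (y, c)) => /=.
  - by rewrite /M; have := normr_ge0 t; lra.
  - by rewrite /M; have := normr_ge0 x; lra.
  - rewrite (le_trans _ (ltW hd))//; move: yb.
    have [hp|hn] := leP 0 h.
      rewrite min_l ?max_r ?lerDl// => /andP[y1 y2].
      by have := ler_norm h; rewrite ler_norml; lra.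
    rewrite min_r ?max_l ?gerDl ?(ltW hn)// => /andP[y1 y2].
    by have := ler_norm (- h); rewrite normrN ler_norml; lra.
  - by rewrite subrr normr0 ltW.
rewrite -mulrA -[leRHS]mulr1 ler_pM2l// mulrC ler_pdivrMr// mul1r /M.
by have := normr_ge0 x; lra.
Qed.

End plane.

(** * Steklov averages and directional inequalities *)

Section steklov.
Context {R : realType}.
Implicit Types (f g : R -> R) (w : R * R -> R) (z : R * R) (x t e d a : R).

Definition between (a b c : R) := Num.min a b <= c <= Num.max a b.

Lemma between_dist a e c : between a (a + e) c -> `|c - a| <= `|e|.
Proof.
rewrite /between; have [hp|hn] := leP 0 e.
  rewrite min_l ?max_r ?lerDl// => /andP[y1 y2].
  by have := ler_norm e; rewrite ler_norml; lra.
rewrite min_r ?max_l ?gerDl ?(ltW hn)// => /andP[y1 y2].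
by have := ler_norm (- e); rewrite normrN ler_norml; lra.
Qed.

(** With e negative the same formula averages over [x + e, x], which serves
    the left half-line. *)
Definition avg e f x := e^-1 * (primitive f (x + e) - primitive f x).

Lemma is_derive_avg e f x : continuous f ->
  is_derive x (1 : R) (avg e f) (e^-1 * (f (x + e) - f x)).
Proof.
move=> cf; have [df _] := primitiveP cf.
exact: (is_deriveZ _ (is_deriveB (is_derive_shift e x df) (df x))).
Qed.

Lemma avg_mean e f x : e != 0 -> continuous f ->
  exists2 c, between x (x + e) c & avg e f x = f c.
Proof.
move=> e0 cf; have [df _] := primitiveP cf.
have [c cb E] := mean_value x (x + e) df.
by exists c => //; rewrite /avg E (addrC x) addrK mulrCA mulVf ?mulr1.
Qed.

(** A pointwise comparison of g shifted by a with f passes to averages, since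
    the difference of the averages is a value of the difference of the
    integrands. *)
Lemma avg_shift_le e f g x a C : e != 0 -> continuous f -> continuous g ->
  (forall y, between x (x + e) y -> g (y + a) - f y <= C) ->
  avg e g (x + a) - avg e f x <= C.
Proof.
move=> e0 cf cg H; have [df _] := primitiveP cf; have [dg _] := primitiveP cg.
have dphi y : is_derive y (1 : R) ((fun y => primitive g (y + a)) - primitive f) (g (y + a) - f y).
  exact: (is_deriveB (is_derive_shift a y dg) (df y)).
have [c cb] := mean_value x (x + e) dphi.
rewrite !fctE (addrC x e) addrK => E; apply: le_trans (H c cb).
rewrite /avg -mulrBr.
have -> : primitive g (x + a + e) - primitive g (x + a) - (primitive f (x + e) - primitive f x) =
  (g (c + a) - f c) * e.
  by rewrite -E; have -> : x + a + e = e + x + a by [ring]; rewrite (addrC x e); ring.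
by rewrite mulrCA mulVf// mulr1.
Qed.

Definition C1plane (f fx ft : R * R -> R) := [/\ continuous fx, continuous ft,
  forall z, is_derive z.1 (1 : R) (fun x => f (x, z.2)) (fx z) &
  forall z, is_derive z.2 (1 : R) (fun t => f (z.1, t)) (ft z)].

Definition xavg e w z := avg e (fun y => w (y, z.2)) z.1.
Definition tavg d w z := avg d (fun s => w (z.1, s)) z.2.
Definition xquot e w z := e^-1 * (w (z.1 + e, z.2) - w z).
Definition tquot d w z := d^-1 * (w (z.1, z.2 + d) - w z).

Lemma continuous_shift1 e w : continuous w -> continuous (fun z => w (z.1 + e, z.2)).
Proof.
move=> cw; apply: continuous2_comp => //; last exact: continuous2_snd.
by move=> z; apply: cvgD; [exact: continuous2_fst|exact: cvg_cst].
Qed.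

Lemma continuous_shift2 e w : continuous w -> continuous (fun z => w (z.1, z.2 + e)).
Proof.
move=> cw; apply: continuous2_comp => //; first exact: continuous2_fst.
by move=> z; apply: cvgD; [exact: continuous2_snd|exact: cvg_cst].
Qed.

Lemma continuous_diffM (f g : R * R -> R) e : continuous f -> continuous g ->
  continuous (fun z => e * (f z - g z)).
Proof.
by move=> cf cg z; apply: cvgM; [exact: cvg_cst|apply: cvgB; [exact: cf|exact: cg]].
Qed.

Lemma continuous_xquot e w : continuous w -> continuous (xquot e w).
Proof. by move=> cw; apply: continuous_diffM => //; exact: continuous_shift1. Qed.

Lemma continuous_tquot e w : continuous w -> continuous (tquot e w).
Proof. by move=> cw; apply: continuous_diffM => //; exact: continuous_shift2. Qed.

Lemma continuous_xavg e w : continuous w -> continuous (xavg e w).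
Proof.
move=> cw; have cp := continuous_primitive1 cw.
exact: (continuous_diffM (continuous_shift1 cp) cp).
Qed.

Lemma continuous_tavg e w : continuous w -> continuous (tavg e w).
Proof.
move=> cw; have cp := continuous_primitive2 cw.
exact: (continuous_diffM (continuous_shift2 cp) cp).
Qed.

Lemma is_derive_xavg e w z : continuous w ->
  is_derive z.1 (1 : R) (fun x => xavg e w (x, z.2)) (xquot e w z).
Proof.
move=> cw; have := is_derive_avg e z.1 (@continuous2_l _ w z.2 cw).
by rewrite /xquot; case: z.
Qed.

Lemma C1plane_tavg d (w wx : R * R -> R) : continuous w -> continuous wx ->
  (forall z, is_derive z.1 (1 : R) (fun x => w (x, z.2)) (wx z)) ->
  C1plane (tavg d w) (tavg d wx) (tquot d w).
Proof.
move=> cw cwx dw; split.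
- exact: continuous_tavg.
- exact: continuous_tquot.
- move=> [x t]; rewrite /tavg/=.
  exact: (is_deriveZ _ (is_deriveB (is_derive_primitive_param x (t + d) cw cwx dw) (is_derive_primitive_param x t cw cwx dw))).
- move=> [x t]; exact: is_derive_avg (@continuous2_r _ w x cw).
Qed.

(** One-sided directional growth bounds the derivative in the direction (a,
    1); the mean value theorem in each variable replaces the chain rule. *)
Lemma directional_derivative_le (V Vx Vt : R * R -> R) x t a C r : C1plane V Vx Vt -> 0 < r ->
  (forall s, 0 < s < r -> V (x + a * s, t + s) - V (x, t) <= C * s) ->
  Vt (x, t) + a * Vx (x, t) <= C.
Proof.
move=> [cx ct dx dt] r0 H; apply/ler_addgt0Pr => e e0.
have a0 : 0 < `|a| + 1 by rewrite ltr_wpDl.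
have e20 : 0 < e / 2 by rewrite divr_gt0.
have [d1 d10 H1] := (continuous2P _).1 ct (x, t) _ e20.
have [d2 d20 H2] := (continuous2P _).1 cx (x, t) _ (divr_gt0 e20 a0).
pose m := Num.min r (Num.min (d1 / (`|a| + 1)) (d2 / (`|a| + 1))).
have m0 : 0 < m by rewrite !lt_min r0 !divr_gt0.
pose s := m / 2.
have s0 : 0 < s by rewrite divr_gt0.
have sm : s < m by rewrite /s; lra.
have sr : s < r by rewrite (lt_le_trans sm)// ge_min lexx.
have sd d : m <= d / (`|a| + 1) -> `|a * s| < d /\ s < d.
  move=> md; have : s < d / (`|a| + 1) by exact: lt_le_trans md.
  rewrite ltr_pdivlMr// normrM (gtr0_norm s0) mulrDr mulr1 (mulrC s) => h.
  by have : 0 <= `|a| * s by [rewrite mulr_ge0// ltW]; lra.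
have [ad1 sd1] : `|a * s| < d1 /\ s < d1 by apply: sd; rewrite /m !ge_min lexx ?orbT.
have [ad2 sd2] : `|a * s| < d2 /\ s < d2 by apply: sd; rewrite /m !ge_min lexx ?orbT.
have [|xi xib Ex] := @mean_value R (fun y => V (y, t + s)) (fun y => Vx (y, t + s)) x (x + a * s).
  by move=> y; exact: (dx (y, t + s)).
have [|ti tib Et] := @mean_value R (fun y => V (x, y)) (fun y => Vt (x, y)) t (t + s).
  by move=> y; exact: (dt (x, y)).
have := H s; rewrite s0 sr => /(_ isT).
have -> : V (x + a * s, t + s) - V (x, t) =
  (Vt (x, ti) + a * Vx (xi, t + s)) * s.
  have -> : V (x + a * s, t + s) - V (x, t) =
     (V (x + a * s, t + s) - V (x, t + s)) + (V (x, t + s) - V (x, t)) by ring.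
  by rewrite Ex Et; ring.
rewrite ler_pM2r// => h.
have k1 := between_dist xib; have k2 := between_dist tib.
have : `|Vt (x, ti) - Vt (x, t)| < e / 2.
  apply: H1 => /=; first by rewrite subrr normr0.
  by rewrite (le_lt_trans k2)// gtr0_norm.
have : `|Vx (xi, t + s) - Vx (x, t)| < e / 2 / (`|a| + 1).
  apply: H2 => /=; first by rewrite (le_lt_trans k1).
  by rewrite (addrC t) addrK gtr0_norm.
rewrite ltr_pdivlMr// => q1 q2.
have q3 : `|a * (Vx (xi, t + s) - Vx (x, t))| <= e / 2.
  rewrite normrM mulrC (le_trans _ (ltW q1))// ler_wpM2l// lerDl//.
move: q2 q3; rewrite ltr_norml ler_norml => /andP[q2 _] /andP[q3 _].
rewrite mulrBr in q3; lra.
Qed.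

(** The correction - xavg (0, t) + w (0, t) depends on t only. It makes the
    averages taken from the two sides of the junction agree with w at x = 0. *)
Definition presmooth e w z := xavg e w z - xavg e w (0, z.2) + w (0, z.2).
Definition smooth e d w := tavg d (presmooth e w).
Definition smooth_x e d w := tavg d (xquot e w).
Definition smooth_t e d w := tquot d (presmooth e w).

Lemma continuous_at0 w : continuous w -> continuous (fun z => w (0, z.2)).
Proof.
by move=> cw; apply: continuous2_comp => //; [move=> z; exact: cvg_cst|exact: continuous2_snd].
Qed.

Lemma continuous_presmooth e w : continuous w -> continuous (presmooth e w).
Proof.
move=> cw; have cX := continuous_xavg (e := e) cw => z.
apply: cvgD; last exact: (continuous_at0 cw).
by apply: cvgB; [exact: cX|exact: (continuous_at0 cX)].
Qed.

Lemma C1plane_smooth e d w : continuous w ->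
  C1plane (smooth e d w) (smooth_x e d w) (smooth_t e d w).
Proof.
move=> cw; apply: C1plane_tavg; [exact: continuous_presmooth|exact: continuous_xquot|].
move=> z; rewrite -[xquot e w z]addr0 -[xquot e w z]subr0.
have h := is_derive_xavg e z cw.
exact: (is_deriveD (is_deriveB h (is_derive_cst (xavg e w (0, z.2)) _ _)) (is_derive_cst (w (0, z.2)) _ _)).
Qed.

Lemma presmooth0 e w t : presmooth e w (0, t) = w (0, t).
Proof. by rewrite /presmooth /= subrr add0r. Qed.

Lemma smooth0 e d w t : smooth e d w (0, t) = tavg d w (0, t).
Proof.
rewrite /smooth /tavg /=; congr (avg d _ t).
by apply/funext => s; rewrite presmooth0.
Qed.

Lemma smooth_t0 e d w t : smooth_t e d w (0, t) = d^-1 * (w (0, t + d) - w (0, t)).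
Proof. by rewrite /smooth_t /tquot /= !presmooth0. Qed.

Lemma smooth_x_le e d w x t L : continuous w -> e != 0 -> d != 0 ->
  (forall s, between t (t + d) s -> `|w (x + e, s) - w (x, s)| <= L * `|e|) ->
  `|smooth_x e d w (x, t)| <= L.
Proof.
move=> cw e0 d0 H.
have [s sb] := avg_mean t d0 (@continuous2_r _ (xquot e w) x (continuous_xquot (e := e) cw)).
rewrite /smooth_x /tavg /= => ->; rewrite /xquot /= normrM normfV mulrC.
by rewrite ler_pdivrMr ?normr_gt0// H.
Qed.

Lemma smooth_dist e d w x t L m : continuous w -> e != 0 -> d != 0 ->
  (forall y s, between t (t + d) s -> between 0 (0 + e) y -> `|w (y, s) - w (0, s)| <= L) ->
  (forall y s, between t (t + d) s -> between x (x + e) y -> `|w (y, s) - w (x, s)| <= L) ->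
  (forall s, between t (t + d) s -> `|w (x, s) - w (x, t)| <= m) ->
  `|smooth e d w (x, t) - w (x, t)| <= 2 * L + m.
Proof.
move=> cw e0 d0 H0 Hx Hm.
have [s sb] := avg_mean t d0 (@continuous2_r _ (presmooth e w) x (continuous_presmooth (e := e) cw)).
rewrite /smooth /tavg /= => ->; rewrite /presmooth /xavg /=.
have [y yb ->] := avg_mean x e0 (@continuous2_l _ w s cw).
have [y0 y0b ->] := avg_mean 0 e0 (@continuous2_l _ w s cw).
have := H0 _ _ sb y0b; have := Hx _ _ sb yb; have := Hm _ sb.
by rewrite !ler_norml; lra.
Qed.

(** If w grows at most like C tau along the direction (a, 1), so do its
    averages. The term L bounds the distance at x = 0 between w and its
    spatial average: differentiated in time by the average over d, the
    correction contributes at most 2 L / d. *)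
Lemma smooth_subsolution e d w x t a C L r : continuous w -> e != 0 -> 0 < d -> 0 < r ->
  (forall y s, between t (t + d) s -> between 0 (0 + e) y -> `|w (y, s) - w (0, s)| <= L) ->
  (forall y s tau, between t (t + d) s -> between x (x + e) y -> 0 < tau < r ->
     w (y + a * tau, s + tau) - w (y, s) <= C * tau) ->
  smooth_t e d w (x, t) + a * smooth_x e d w (x, t) <= C + d^-1 * (2 * L).
Proof.
move=> cw e0 d0 r0 H0 H.
have cX := continuous_xavg (e := e) cw.
have VC := C1plane_tavg d cX (continuous_xquot (e := e) cw) (fun z => is_derive_xavg e z cw).
have K := @directional_derivative_le _ _ _ x t a C r VC r0.
have {}K : tquot d (xavg e w) (x, t) + a * tavg d (xquot e w) (x, t) <= C.
  apply: K => s /andP[s0 sr]; rewrite /tavg /=.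
  apply: avg_shift_le; first (by rewrite gt_eqF); try exact: continuous2_r cX.
  move=> tau taub; rewrite /xavg /=.
  apply: avg_shift_le => //; try exact: continuous2_l cw.
  by move=> y yb; apply: H => //; rewrite s0.
have tb : between t (t + d) t by rewrite /between min_l ?max_r ?lexx ?lerDl ltW.
have tb' : between t (t + d) (t + d) by rewrite /between min_l ?max_r ?lexx ?lerDl ?ltW.
have c0 s : between t (t + d) s -> `|w (0, s) - xavg e w (0, s)| <= L.
  move=> sb; rewrite /xavg /=.
  have [y yb ->] := avg_mean 0 e0 (@continuous2_l _ w s cw).
  by rewrite distrC; exact: H0.
have -> : smooth_t e d w (x, t) = tquot d (xavg e w) (x, t) +
   d^-1 * ((w (0, t + d) - xavg e w (0, t + d)) - (w (0, t) - xavg e w (0, t))).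
  by rewrite /smooth_t /tquot /presmooth /=; ring.
rewrite addrAC lerD// ler_pM2l ?invr_gt0//.
have := c0 _ tb; have := c0 _ tb'; rewrite !ler_norml; lra.
Qed.

Lemma convex_function_three_points f y1 x y2 :
  convex_function [set: convex_lmodType R^o] f -> y1 < x -> x < y2 ->
  f x * (y2 - y1) <= f y1 * (y2 - x) + f y2 * (x - y1).
Proof.
move=> cf y1x xy2; have d0 : 0 < y2 - y1 by rewrite subr_gt0 (lt_trans y1x).
pose p := (y2 - x) / (y2 - y1).
have p0 : 0 <= p by rewrite divr_ge0 ?subr_ge0 ?ltW// (lt_trans y1x).
have p1 : p <= 1 by rewrite ler_pdivrMr// mul1r lerD2l lerN2 ltW.
have := cf (Itv01 p0 p1) y1 y2 (mem_set I) (mem_set I).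
have -> : (conv (Itv01 p0 p1) (y1 : convex_lmodType R^o) y2) = x.
  rewrite /conv/= /unstable.onem /GRing.scale/= /p; field; by rewrite gt_eqF.
rewrite convRE /= /unstable.onem => h.
have -> : f y1 * (y2 - x) + f y2 * (x - y1) = (p * f y1 + (1 - p) * f y2) * (y2 - y1).
  by rewrite /p; field; rewrite gt_eqF.
by rewrite ler_pM2r.
Qed.

(** The supremum of the left slopes at x is finite because every right slope
    bounds it, and it is a subgradient. *)
Lemma exists_subgradient f x : convex_function [set: convex_lmodType R^o] f ->
  exists a, forall y, f x + a * (y - x) <= f y.
Proof.
move=> cf.
pose A : set R := [set s | exists2 y, y < x & s = (f x - f y) / (x - y)].
have Aub y : x < y -> ubound A ((f y - f x) / (y - x)).
  move=> xy _ [z zx ->].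
  have h := convex_function_three_points cf zx xy.
  by rewrite ler_pdivrMr ?subr_gt0// mulrAC ler_pdivlMr ?subr_gt0//; lra.
have supA : has_sup A.
  split; first by exists ((f x - f (x - 1)) / (x - (x - 1))), (x - 1) => //; rewrite ltrBlDr ltrDl.
  by exists ((f (x + 1) - f x) / (x + 1 - x)); apply: Aub; rewrite ltrDl.
exists (sup A) => y; rewrite addrC -lerBrDr.
have [yx|xy|->] := ltgtP y x.
- have : (f x - f y) / (x - y) <= sup A by apply: sup_upper_bound => //; exists y.
  by rewrite ler_pdivrMr ?subr_gt0//; lra.
- have : sup A <= (f y - f x) / (y - x) by apply: ge_sup => //; [case: supA|exact: Aub].
  by rewrite ler_pdivlMr ?subr_gt0.
- by rewrite !subrr mulr0.
Qed.

End steklov.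

(** * Smooth and glued test functions *)

Section tests.
Context {R : realType}.
Implicit Types (f g : R -> R) (w : R * R -> R) (z : R * R) (x t e d a : R).

Lemma C1plane_continuous (f fx ft : R * R -> R) : C1plane f fx ft -> continuous f.
Proof.
move=> [cx ct dx dt]; apply/continuous2P => z e e0.
have [d1 d10 H1] := (continuous2P _).1 cx z 1 ltr01.
have [d2 d20 H2] := (continuous2P _).1 ct z 1 ltr01.
pose K := `|fx z| + `|ft z| + 1.
have K0 : 0 < K by rewrite ltr_wpDl// addr_ge0.
pose m := Num.min (Num.min d1 d2) (e / (2 * K)).
exists m; first by rewrite !lt_min d10 d20 divr_gt0// mulr_gt0.
move=> z'; rewrite /m !lt_min => /andP[/andP[a1 a2] a3] /andP[/andP[b1 b2] b3].
have [|xi xib Ex] := @mean_value R (fun y => f (y, z'.2)) (fun y => fx (y, z'.2)) z.1 (z.1 + (z'.1 - z.1)).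
  by move=> y; exact: (dx (y, z'.2)).
have [|ti tib Et] := @mean_value R (fun y => f (z.1, y)) (fun y => ft (z.1, y)) z.2 (z.2 + (z'.2 - z.2)).
  by move=> y; exact: (dt (z.1, y)).
have k1 := between_dist xib; have k2 := between_dist tib.
have q1 : `|fx (xi, z'.2)| <= K.
  have : `|fx (xi, z'.2) - fx z| < 1 by apply: H1 => //=; exact: le_lt_trans a1.

  have := ler_normD (fx (xi, z'.2) - fx z) (fx z); rewrite subrK /K.
  by have := normr_ge0 (ft z); lra.
have q2 : `|ft (z.1, ti)| <= K.
  have : `|ft (z.1, ti) - ft z| < 1.
    by apply: H2 => //=; [rewrite subrr normr0|exact: le_lt_trans b2].
  have := ler_normD (ft (z.1, ti) - ft z) (ft z); rewrite subrK /K.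
  by have := normr_ge0 (fx z); lra.
move: Ex Et; rewrite (addrC z.1) (addrC z.2) !subrK => Ex Et.
have -> : f z' - f z = (f (z'.1, z'.2) - f (z.1, z'.2)) + (f (z.1, z'.2) - f (z.1, z.2)).
  by case: z' {a1 a2 a3 b1 b2 b3 xib Ex Et tib k1 k2 q1} => ? ?; case: z {K K0 m H1 H2 q2} => ? ? /=; ring.
rewrite Ex Et (le_lt_trans (ler_normD _ _))// !normrM (splitr e) ltrD//.
  rewrite (le_lt_trans (ler_wpM2r _ q1))// mulrC -ltr_pdivlMr//.
  by rewrite -mulrA -invfM.
rewrite (le_lt_trans (ler_wpM2r _ q2))// mulrC -ltr_pdivlMr//.
by rewrite -mulrA -invfM.
Qed.

(** Stability under translations to one side gives points of the set
    arbitrarily close to each of its points, so that the derivative relative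
    to the set is a limit along a proper filter. *)
Definition halfline (Om : set R) := (forall x h, Om x -> 0 < h -> Om (x + h)) \/
  (forall x h, Om x -> 0 < h -> Om (x - h)).

(** The relative difference quotient is a restriction of the two-sided one, so
    the relative derivative is the ordinary partial derivative. *)
Lemma C1_on_plane (f fx ft : R * R -> R) T (Om : set R) : C1plane f fx ft -> halfline Om ->
  C1_on T Om f /\ forall z, Om z.1 -> dx Om f z = fx z /\ dt f z = ft z.
Proof.
move=> C hO; have cf := C1plane_continuous C; case: C => cx ct Dx Dt.
have cvx z : dxq Om f z --> fx z.
  have [dr dv] := Dx z.
  have h : h^-1 *: (f (h *: 1 + z.1, z.2) - f (z.1, z.2)) @[h --> (0 : R)^'] --> fx z.
    by rewrite -dv; exact: dr.
  rewrite /dxq (_ : (fun h : R => h^-1 * (f (z.1 + h, z.2) - f z)) =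
    (fun h : R => h^-1 *: (f (h *: 1 + z.1, z.2) - f (z.1, z.2)))); last first.
    apply/funext => k; rewrite [k *: 1]mulr1 (addrC k).
    by case: z {dr dv h} => ? ? /=.
  apply: cvg_trans h; apply: cvg_app; exact: cvg_within.
have lx z : Om z.1 -> dx Om f z = fx z.
  move=> Oz; rewrite /dx; apply: cvg_lim => //; last exact: cvx.
  apply: Build_ProperFilter_ex => P.
  rewrite /within /= near_withinE => /nbhs_ballP[r /= r0 Hr].
  have r20 : 0 < r / 2 by rewrite divr_gt0.
  case: hO => hO.
    exists (r / 2); apply: Hr => //=; rewrite ?gt_eqF//; last exact: hO.
    by rewrite /ball/= sub0r normrN gtr0_norm//; lra.
  exists (- (r / 2)); apply: Hr => //=; rewrite ?oppr_eq0 ?gt_eqF//; last exact: hO.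
  by rewrite /ball/= sub0r opprK gtr0_norm//; lra.
have lt z : dt f z = ft z by rewrite /dt derive1E; apply: derive_val.
split; last by move=> z Oz; split; [exact: lx|exact: lt].
split => /=.
- exact: continuous_subspaceT.
- by move=> z _; apply/cvg_ex; exists (fx z); exact: cvx.
- by move=> z _; have [] := Dt z.
- apply: (@subspace_eq_continuous _ _ _ fx); last exact: continuous_subspaceT.
  move=> z; rewrite inE => -[Oz _]; exact/esym/lx.
- rewrite (_ : dt f = ft); first exact: continuous_subspaceT.
  by apply/funext => z; exact: lt.
Qed.

Definition glue (f1 f2 : R * R -> R) z := if 0 <= z.1 then f1 z else f2 z.

Lemma continuous_glue (f1 f2 : R * R -> R) : continuous f1 -> continuous f2 ->
  (forall t, f1 (0, t) = f2 (0, t)) -> continuous (glue f1 f2).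
Proof.
move=> c1 c2 f12; apply/continuous2P => z e e0.
have [d1 d10 H1] := (continuous2P _).1 c1 z e e0.
have [d2 d20 H2] := (continuous2P _).1 c2 z e e0.
have [z0|z0|z0] := ltgtP 0 z.1.
+ exists (Num.min d1 z.1); first by rewrite lt_min d10.
  move=> z'; rewrite !lt_min => /andP[a1 a2] /andP[b1 b2].
  have z'0 : 0 <= z'.1 by move: a2; rewrite ltr_norml; lra.
  by rewrite /glue z'0 ltW//; exact: H1.
+ exists (Num.min d2 (- z.1)); first by rewrite lt_min d20 oppr_gt0.
  move=> z'; rewrite !lt_min => /andP[a1 a2] /andP[b1 b2].
  have z'0 : z'.1 < 0 by move: a2; rewrite ltr_norml; lra.
  by rewrite /glue !leNgt z'0 z0 /=; exact: H2.
+ exists (Num.min d1 d2); first by rewrite lt_min d10.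
  move=> z'; rewrite !lt_min => /andP[a1 a2] /andP[b1 b2].
  rewrite /glue -z0 lexx; case: ifP => _; first exact: H1.
  have -> : f1 z = f2 z by case: z z0 {H1 H2 a1 a2 b1 b2} => x t /= <-.
  exact: H2.
Qed.

Lemma PC1_glue (f1 f1x f1t f2 f2x f2t : R * R -> R) T :
  C1plane f1 f1x f1t -> C1plane f2 f2x f2t -> (forall t, f1 (0, t) = f2 (0, t)) ->
  PC1 T (glue f1 f2) f1 f2.
Proof.
move=> C1 C2 f12; split.
- apply: continuous_subspaceT.
  exact: (continuous_glue (C1plane_continuous C1) (C1plane_continuous C2) f12).
- apply: (C1_on_plane T C1 _).1; left => x h /=; rewrite !in_itv/= !andbT => *.
  by rewrite addr_ge0// ltW.
- apply: (C1_on_plane T C2 _).1; right => x h /=; rewrite !in_itv/= => *.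
  lra.
- by move=> z; rewrite inE => -[/= + _]; rewrite in_itv/= andbT /glue => ->.
- move=> z; rewrite inE => -[/= + _]; rewrite in_itv/= /glue => z0.
  have [z0'|//] := leP 0 z.1.
  have {z0'}z0 : z.1 = 0 by apply/eqP; rewrite eq_le z0.
  by case: z z0 => x t /= ->.
Qed.

(** Test functions that are glued from two functions smooth on the whole plane
    suffice for the comparison; for them all one-sided derivatives in the
    definition are the partial derivatives of the two pieces. *)
Lemma FLtm_test (cmp : R -> R -> Prop) T (H1 H2 : R -> R -> R -> R) (ph1 ph2 : R -> R -> R)
    (A : R -> R) (u : R * R -> R) (b : R -> R) (f1 f1x f1t f2 f2x f2t : R * R -> R) x0 t0 :
  FLtm_solution cmp T H1 H2 ph1 ph2 A u -> L1 T b ->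
  C1plane f1 f1x f1t -> C1plane f2 f2x f2t -> (forall t, f1 (0, t) = f2 (0, t)) ->
  0 < t0 -> t0 < T ->
  (let w z := u z - (\int[leb R]_(s in `]0, z.2[) b s + glue f1 f2 z) in
   \forall z \near (x0, t0), 0 < z.2 -> z.2 < T -> cmp (w z) (w (x0, t0))) ->
  [/\ x0 = 0 -> junction_condition cmp T H1 H2 ph1 ph2 A b t0
         (f1t (0, t0)) (f1x (0, t0)) (f2x (0, t0)),
      0 < x0 -> interior_condition cmp T `]0, +oo[ H1 b x0 t0
         (f1t (x0, t0)) (f1x (x0, t0)) &
      x0 < 0 -> interior_condition cmp T `]-oo, 0[ H2 b x0 t0
         (f2t (x0, t0)) (f2x (x0, t0))].
Proof.
move=> [_ _ sol] ib C1 C2 f12 t00 t0T loc.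
have P := PC1_glue T C1 C2 f12.
have E : strip T [set: R] (x0, t0) by split => //=; rewrite in_itv/= t00.
have [|S1 S2 S3] := sol b _ _ _ x0 t0 ib P E.
  apply: filterS loc => z h [_ /=]; rewrite in_itv/= => /andP[? ?]; exact: h.
have h1 : halfline `[0, +oo[.
  by left => x h /=; rewrite !in_itv/= !andbT => *; rewrite addr_ge0// ltW.
have h2 : halfline `]-oo, 0].
  by right => x h /=; rewrite !in_itv/= => *; lra.
have [_ D1] := C1_on_plane T C1 h1; have [_ D2] := C1_on_plane T C2 h2.
split=> x00.
- have := S1 x00.
  have [|-> ->] := D1 (0, t0); first by rewrite /= in_itv/= lexx.
  by have [|-> _] := D2 (0, t0); first by rewrite /= in_itv/= lexx.
- have := S2 x00.
  have [|_] := D1 (x0, t0); first by rewrite /= in_itv/= andbT ltW.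
  rewrite /dt /=.
  have -> : (fun s => glue f1 f2 (x0, s)) = fun s => f1 (x0, s).
    by apply/funext => s; rewrite /glue /= ltW.
  move=> ->.
  have -> // : derive1 (fun x => glue f1 f2 (x, t0)) x0 = f1x (x0, t0).
  case: C1 => _ _ d _; have := d (x0, t0) => /= dd.
  rewrite derive1E -(@derive_val _ _ _ _ _ _ _ dd); apply: near_eq_derive.
  near=> x; rewrite /glue /= ifT//; apply: ltW; near: x; exact: lt_nbhsr.
- have := S3 x00.
  have [|_] := D2 (x0, t0); first by rewrite /= in_itv/= ltW.
  rewrite /dt /=.
  have -> : (fun s => glue f1 f2 (x0, s)) = fun s => f2 (x0, s).
    by apply/funext => s; rewrite /glue /= leNgt x00.
  move=> ->.
  have -> // : derive1 (fun x => glue f1 f2 (x, t0)) x0 = f2x (x0, t0).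
  case: C2 => _ _ d _; have := d (x0, t0) => /= dd.
  rewrite derive1E -(@derive_val _ _ _ _ _ _ _ dd); apply: near_eq_derive.
  near=> x; rewrite /glue /= ifF//; apply: lt_geF; near: x; exact: lt_nbhsl.
Unshelve. all: by end_near. Qed.

End tests.

(** * Interior maxima on space-time boxes *)

Section maxima.
Context {R : realType}.
Implicit Types (f g : R -> R) (w u : R * R -> R) (z : R * R) (x t e d a T : R).

(** Composing with this projection on [0, t3] extends a function continuous on
    times in [0, T) to a function continuous on the whole plane. *)
Definition clamp (t3 t : R) : R := Num.max 0 (Num.min t t3).

Lemma clamp_id t3 t : 0 <= t -> t <= t3 -> clamp t3 t = t.
Proof. by move=> t0 tt; rewrite /clamp min_l// max_r. Qed.

Lemma clamp_itv t3 t : 0 <= t3 -> 0 <= clamp t3 t <= t3.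
Proof.
by move=> t30; rewrite /clamp le_max lexx/= ge_max t30 ge_min lexx orbT.
Qed.

Lemma clamp_dist t3 s t : `|clamp t3 s - clamp t3 t| <= `|s - t|.
Proof.
rewrite /clamp /Num.max /Num.min.
have h1 := ler_norm (s - t); have h2 := ler_norm (t - s); rewrite (distrC t s) in h2.
have h3 := normr_ge0 (s - t).
by case: (ltP s t3) => ?; case: (ltP t t3) => ?; do ?case: (ltP 0 _) => ?;
  rewrite ler_norml; apply/andP; split; lra.
Qed.

Lemma continuous_clamp (w : R * R -> R) T t3 : 0 <= t3 -> t3 < T ->
  {within [set: R] `*` `[0, T[, continuous w} ->
  continuous (fun z => w (z.1, clamp t3 z.2)).
Proof.
move=> t30 t3T cw; apply/continuous2P => z e e0.
have Ez x t : ([set: R] `*` `[0, T[)%classic (x, clamp t3 t).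
  split => //=; rewrite in_itv/=; have /andP[-> h] := clamp_itv t t30.
  exact: le_lt_trans t3T.
have : w z' @[z' --> within ([set: R] `*` `[0, T[) (nbhs (z.1, clamp t3 z.2))] --> w (z.1, clamp t3 z.2).
  by rewrite (nbhs_subspace_in (Ez z.1 z.2)); exact: cw.
move=> /cvgrPdistC_lt/(_ e e0); rewrite near_withinE => /nbhs2P[d d0 H].
exists d => // z' h1 h2.
exact: (H (z'.1, clamp t3 z'.2) h1 (le_lt_trans (clamp_dist _ _ _) h2) (Ez _ _)).
Qed.

Lemma continuous_clamp_fun f t3 (e0 : forall e, 0 < e -> exists2 d, 0 < d & forall s t,
    0 <= s -> s <= t -> t <= t3 -> t - s < d -> `|f t - f s| <= e) : 0 <= t3 ->
  continuous (fun z => f (clamp t3 z.2)).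
Proof.
move=> t30; apply/continuous2P => z e ep.
have [d d0 H] := e0 (e / 2) (divr_gt0 ep (ltr0n _ 2)).
exists d => // z' _ h.
apply: (@le_lt_trans _ _ (e / 2)); last lra.
have := clamp_dist t3 z'.2 z.2.
have /andP[a1 a2] := clamp_itv z'.2 t30; have /andP[b1 b2] := clamp_itv z.2 t30.
case: (leP (clamp t3 z.2) (clamp t3 z'.2)) => hh k.
  by apply: H => //; rewrite (le_lt_trans _ h)// (le_trans _ k)// ler_norm.
by rewrite distrC; apply: H => //; rewrite ?ltW// (le_lt_trans _ h)// (le_trans _ k)// distrC ler_norm.
Qed.

(** Subtracting this function from a bounded one keeps maxima away from times
    much larger than s1. Being increasing in t, it has the right sign in the
    equation. *)
Definition barrier (sg la s1 : R) z := sg * expR (la * (z.2 - s1)).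
Definition barrier_t (sg la s1 : R) z := sg * (la * expR (la * (z.2 - s1))).

Lemma is_derive_barrier sg la s1 x t :
  is_derive t (1 : R) (fun s => barrier sg la s1 (x, s)) (barrier_t sg la s1 (x, t)).
Proof.
rewrite /barrier /barrier_t /=; apply: (@is_deriveZ _ _ _ (fun s => expR (la * (s - s1)))).
rewrite mulrC; apply: (@is_derive1_comp _ expR (fun s => la * (s - s1))).
rewrite -[X in is_derive _ _ _ X]mulr1 -[X in la * X]subr0.
exact: (is_deriveZ _ (is_deriveB (is_derive_id _ _) (is_derive_cst _ _ _))).
Qed.

Lemma continuous_barrier sg la s1 : continuous (barrier sg la s1).
Proof.
move=> z; apply: cvgM; first exact: cvg_cst.
apply: (@continuous_comp _ _ _ (fun z : R * R => la * (z.2 - s1)) expR); last exact: continuous_expR.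
apply: cvgM; first exact: cvg_cst.
by apply: cvgB; [exact: continuous2_snd|exact: cvg_cst].
Qed.

Lemma continuous_barrier_t sg la s1 : continuous (barrier_t sg la s1).
Proof.
rewrite (_ : barrier_t sg la s1 = barrier (sg * la) la s1); first exact: continuous_barrier.
by apply/funext => z; rewrite /barrier_t /barrier mulrA.
Qed.

Lemma barrier_t_gt0 sg la s1 z : 0 < sg -> 0 < la -> 0 < barrier_t sg la s1 z.
Proof. by move=> *; rewrite !mulr_gt0// expR_gt0. Qed.

(** On the bottom and on the lateral sides g is at most c, and the barrier,
    equal to sg < g (x1, s1) - c at time s1 and very large at s2, excludes the
    top. So a maximum of the difference over the box lies inside. *)
Lemma box_max (g : R * R -> R) (rho s0 s1 s2 c x1 : R) : continuous g ->
  `|x1| <= rho -> s0 <= s1 -> s1 < s2 ->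
  (forall x, `|x| <= rho -> g (x, s0) <= c) ->
  (forall x t, `|x| = rho -> s0 <= t <= s2 -> g (x, t) <= c) ->
  c < g (x1, s1) ->
  exists sg la xs ts, [/\ 0 < sg, 0 < la, `|xs| < rho, s0 < ts < s2 &
    forall x t, `|x| <= rho -> s0 <= t <= s2 ->
      g (x, t) - barrier sg la s1 (x, t) <= g (xs, ts) - barrier sg la s1 (xs, ts)].
Proof.
move=> cg x1r s01 s12 bot lat top.
have rho0 : 0 <= rho by exact: le_trans x1r.
have cK : compact (`[- rho, rho] `*` `[s0, s2] : set (R * R)).
  by apply: compact_setX; exact: segment_compact.
have inK x t : ((x, t) \in (`[- rho, rho] `*` `[s0, s2])%classic) = (`|x| <= rho) && (s0 <= t <= s2).
  by apply/idP/idP; rewrite inE /= !in_itv/= -ler_norml => /andP.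
have K0 : (`[- rho, rho] `*` `[s0, s2] : set (R * R)) !=set0.
  by exists (x1, s1); apply/set_mem; rewrite inK x1r s01 ltW.
have [[xM tM] _ HM] := compact_EVT_max K0 cK (continuous_subspaceT cg).
set M := g (xM, tM) in HM.
pose sg := (g (x1, s1) - c) / 2.
have sg0 : 0 < sg by rewrite divr_gt0// subr_gt0.
pose la := (`|M - c| + 1) / (sg * (s2 - s1)).
have la0 : 0 < la by rewrite divr_gt0 ?ltr_wpDl// mulr_gt0// subr_gt0.
have cgp : continuous (fun z => g z - barrier sg la s1 z).
  by move=> z; apply: cvgB; [exact: cg|exact: continuous_barrier].
have [[xs ts] zK Hz] := compact_EVT_max K0 cK (continuous_subspaceT cgp).
exists sg, la, xs, ts; move: zK; rewrite inK => /andP[xsr /andP[ts0 ts2]].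
have Hx1 : c + sg <= g (xs, ts) - barrier sg la s1 (xs, ts).
  have := Hz (x1, s1); rewrite inK x1r s01 (ltW s12) => /(_ isT).
  rewrite {1}/barrier /= subrr mulr0 expR0 mulr1; apply: le_trans.
  by rewrite /sg; lra.
have pp : 0 <= barrier sg la s1 (xs, ts) by rewrite mulr_ge0 ?expR_ge0// ltW.
split => //.
- rewrite lt_neqAle xsr andbT; apply/eqP => E.
  by have := lat _ ts E; rewrite ts0 ts2 => /(_ isT); lra.
- rewrite !lt_neqAle ts0 ts2 !andbT; apply/andP; split; apply/eqP => E.
    by have := bot _ xsr; rewrite E; lra.
  have : g (xs, ts) <= M by apply: HM; rewrite inK xsr ts0 ts2.
  have : `|M - c| + 1 <= barrier sg la s1 (xs, ts).
    rewrite /barrier /= E.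
    apply: (@le_trans _ _ (sg * (1 + la * (s2 - s1)))); last first.
      by rewrite ler_pM2l// expR_ge1Dx.
    rewrite mulrDr mulr1 (_ : sg * (la * (s2 - s1)) = `|M - c| + 1); first lra.
    rewrite /la; field; rewrite subr_eq0 !gt_eqF//.
  have := ler_norm (M - c); lra.
- by move=> x t xr tt; apply: (Hz (x, t)); rewrite inK xr.
Qed.

Lemma Rint_norm_le T (b : R -> R) t : 0 <= t -> t <= T -> L1 T b ->
  `|\int[leb R]_(s in `]0, t[) b s| <= \int[leb R]_(s in `]0, T[) `|b s|.
Proof.
move=> t0 tT bi; apply: le_trans.
  apply: le_normr_Rintegral; first exact: measurable_itv_leb.
  exact: (L1_sub (lexx 0) tT bi).
by apply: (Rint_le t0 tT (lexx T) (L1_norm bi)).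
Qed.

Lemma continuous_Rint_clamp T (b : R -> R) t3 : L1 T b -> 0 <= t3 -> t3 <= T ->
  continuous (fun z : R * R => \int[leb R]_(s in `]0, (clamp t3 z.2)[) b s).
Proof.
move=> bi t30 t3T; apply: (@continuous_clamp_fun (fun t => \int[leb R]_(s in `]0, t[) b s) t3 _ t30) => e e0.
have [d d0 H] := Rint_unif_continuous bi e0.
by exists d => // s t s0 st tt; apply: H => //; exact: le_trans t3T.
Qed.

End maxima.

(** * Monotonicity of subsolutions along lines *)

Section subsolutions.
Context {R : realType}.
Implicit Types (f g : R * R -> R) (w u : R * R -> R) (z : R * R) (x t e d a T : R).

Lemma C1planeD f fx ft g gx gt : C1plane f fx ft -> C1plane g gx gt ->
  C1plane (fun z => f z + g z) (fun z => fx z + gx z) (fun z => ft z + gt z).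
Proof.
move=> [c1 c2 d1 d2] [c3 c4 d3 d4]; split.
- by move=> z; apply: cvgD; [exact: c1|exact: c3].
- by move=> z; apply: cvgD; [exact: c2|exact: c4].
- by move=> z; exact: (is_deriveD (d1 z) (d3 z)).
- by move=> z; exact: (is_deriveD (d2 z) (d4 z)).
Qed.

Lemma C1plane_barrier sg la s1 : C1plane (@barrier R sg la s1) (fun=> 0) (barrier_t sg la s1).
Proof.
split.
- by move=> z; exact: cvg_cst.
- exact: continuous_barrier_t.
- by move=> z; exact: (is_derive_cst (barrier sg la s1 (0, z.2)) z.1 1).
- by case=> x t; exact: is_derive_barrier.
Qed.

Definition linform (p q : R) z := p * z.1 + q * z.2.

Lemma C1plane_linform p q : C1plane (linform p q) (fun=> p) (fun=> q).
Proof.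
split; try by move=> z; exact: cvg_cst.
- move=> z.
  have h : is_derive z.1 (1 : R) (p *: (id : R -> R) + cst (q * z.2)) (p *: 1 + 0).
    exact: (is_deriveD (is_deriveZ _ (is_derive_id _ _)) (is_derive_cst _ _ _)).
  by apply: (is_derive_eq h); rewrite addr0; exact: mulr1.
- move=> z.
  have h : is_derive z.2 (1 : R) (cst (p * z.1) + q *: (id : R -> R)) (0 + q *: 1).
    exact: (is_deriveD (is_derive_cst _ _ _) (is_deriveZ _ (is_derive_id _ _))).
  by apply: (is_derive_eq h); rewrite add0r; exact: mulr1.
Qed.

Definition parabola (a m N : R) z := N * ((z.1 - (m + a * z.2)) * (z.1 - (m + a * z.2))).

Lemma continuous_drift a m : continuous (fun z : R * R => z.1 - (m + a * z.2)).
Proof.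
move=> z; apply: cvgB; first exact: continuous2_fst.
apply: cvgD; first exact: cvg_cst.
by apply: cvgM; [exact: cvg_cst|exact: continuous2_snd].
Qed.

Lemma C1plane_parabola a m N : C1plane (parabola a m N)
  (fun z => 2 * N * (z.1 - (m + a * z.2))) (fun z => - a * (2 * N * (z.1 - (m + a * z.2)))).
Proof.
have cd := @continuous_drift a m; split.
- by move=> z; apply: cvgM; [exact: cvg_cst|exact: cd].
- by move=> z; apply: cvgM; [exact: cvg_cst|apply: cvgM; [exact: cvg_cst|exact: cd]].
- move=> z.
  have d1 : is_derive z.1 (1 : R) ((id : R -> R) - cst (m + a * z.2)) (1 - 0).
    exact: (is_deriveB (is_derive_id _ _) (is_derive_cst _ _ _)).
  apply: (is_derive_eq (is_deriveZ N (is_deriveM d1 d1))).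
  by rewrite !fctE /GRing.scale/=; ring.
- move=> z.
  have d1 : is_derive z.2 (1 : R) (cst z.1 - (cst m + a *: (id : R -> R))) (0 - (0 + a *: 1)).
    exact: (is_deriveB (is_derive_cst _ _ _) (is_deriveD (is_derive_cst _ _ _) (is_deriveZ a (is_derive_id _ _)))).
  apply: (is_derive_eq (is_deriveZ N (is_deriveM d1 d1))).
  by rewrite !fctE /GRing.scale/=; ring.
Qed.

Definition interior_subsolution T (Om : set R) (H : R -> R -> R -> R) u :=
  forall (b : R -> R) f fx ft x0 t0, L1 T b -> C1plane f fx ft -> Om x0 -> 0 < t0 -> t0 < T ->
  (let w z := u z - (\int[leb R]_(s in `]0, z.2[) b s + f z) in
   \forall z \near (x0, t0), 0 < z.2 -> z.2 < T -> w z <= w (x0, t0)) ->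
  interior_condition (fun a c => a <= c) T Om H b x0 t0 (ft (x0, t0)) (fx (x0, t0)).

(** A smooth function is its own gluing, which turns the definition into the
    usual test on each open half-line. *)
Lemma FLtm_interior T H1 H2 ph1 ph2 A u : FLtm_subsolution T H1 H2 ph1 ph2 A u ->
  interior_subsolution T `]0, +oo[ H1 u /\ interior_subsolution T `]-oo, 0[ H2 u.
Proof.
move=> sol; have glueff f : glue f f = f by apply/funext => z; rewrite /glue; case: ifP.
split=> b f fx ft x0 t0 ib C O0 t00 t0T loc.
- have [|_ h _] := FLtm_test sol ib C C (fun=> erefl) t00 t0T (x0 := x0); first by rewrite glueff.
  by apply: h; move: O0; rewrite /= in_itv/= andbT.
- have [|_ _ h] := FLtm_test sol ib C C (fun=> erefl) t00 t0T (x0 := x0); first by rewrite glueff.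
  by apply: h; move: O0; rewrite /= in_itv/=.
Qed.

(** The subsolution is Lipschitz in x, so at a contact point the slope of a
    test function is bounded: only slopes in a compact set matter, and the
    regularity of H in time, which is uniform on compact sets only, applies. *)
Definition x_lipschitz_on T u (r L : R) := forall t x y, 0 <= t -> t < T ->
  `|x| <= r -> `|y| <= r -> `|u (x, t) - u (y, t)| <= L * `|x - y|.

(** If u - int b increased between s0 and s1 along the line x = m + a t, then
    subtracting a steep parabola N (x - m - a t)^2 and a barrier in time would
    produce an interior maximum in a thin tube around the line. The parabola
    is constant along the line, so the test reduces to: time derivative of the
    barrier <= 0, which is false. Comparing with the centre of the tube bounds
    the slope there by 2 L. *)
Lemma le_along_transport T Om H u (b : R -> R) (M r L rho s0 s1 s2 a m : R) :
  interior_subsolution T Om H u ->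
  {within [set: R] `*` `[0, T[, continuous u} ->
  (forall x t, 0 <= t -> t < T -> `|u (x, t)| <= M) ->
  0 <= L -> x_lipschitz_on T u r L -> L1 T b ->
  0 <= s0 -> s0 < s1 -> s1 < s2 -> s2 < T -> 0 < rho ->
  (forall y t, s0 <= t <= s2 -> `|y - (m + a * t)| <= rho -> Om y /\ `|y| <= r) ->
  (forall y t p, s0 <= t <= s2 -> `|y - (m + a * t)| <= rho -> `|p| <= 2 * L + 1 ->
     a * p - b t <= H t y p) ->
  u (m + a * s1, s1) - \int[leb R]_(s in `]0, s1[) b s <=
  u (m + a * s0, s0) - \int[leb R]_(s in `]0, s0[) b s.
Proof.
move=> sol cu uM L0 lipu ib s00 s01 s12 s2T rho0 tube Hle.
set F := fun t => \int[leb R]_(s in `]0, t[) b s.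
rewrite -/(F s1) -/(F s0) leNgt; apply/negP => gap.
set rhs := u (m + a * s0, s0) - F s0 in gap.
set lhs := u (m + a * s1, s1) - F s1 in gap.
pose ga := lhs - rhs; have ga0 : 0 < ga by rewrite subr_gt0.
pose c := rhs + ga / 2.
pose MF := \int[leb R]_(s in `]0, T[) `|b s|.
have s20 : 0 <= s2 by lra.
have FM t : 0 <= t -> t <= s2 -> `|F t| <= MF.
  by move=> t0 tt; apply: Rint_norm_le => //; lra.
(* The first term makes L |y| - N y^2 <= ga / 2, which controls the bottom of
   the tube; the second makes N rho^2 exceed every bound of u - int b, which
   controls its sides. *)
pose N := L ^+ 2 / (2 * ga) + ((M + MF + `|c|) / rho ^+ 2 + 1).
have rho20 : 0 < rho ^+ 2 by rewrite exprn_gt0.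
have M0 : 0 <= M by apply: le_trans (uM 0 0 (lexx _) _); rewrite ?normr_ge0//; lra.
have MF0 : 0 <= MF by apply: Rintegral_ge0 => *; exact: normr_ge0.
have K0 : 0 <= (M + MF + `|c|) / rho ^+ 2 by rewrite divr_ge0 ?addr_ge0// ltW.
have L20 : 0 <= L ^+ 2 / (2 * ga) by rewrite divr_ge0 ?sqr_ge0// mulr_ge0// ltW.
have N0 : 0 < N by rewrite /N; lra.
have NL y : L * `|y| - N * (y * y) <= ga / 2.
  have : 0 <= (L * `|y| - ga) ^+ 2 / (2 * ga) by rewrite divr_ge0 ?sqr_ge0// mulr_ge0// ltW.
  have -> : (L * `|y| - ga) ^+ 2 / (2 * ga) = L ^+ 2 / (2 * ga) * (`|y| * `|y|) - L * `|y| + ga / 2.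
    by field; rewrite gt_eqF.
  rewrite -normrM ger0_norm -?expr2 ?sqr_ge0// /N.
  have := sqr_ge0 y; have := mulr_ge0 K0 (sqr_ge0 y); lra.
have Nrho : M + MF + `|c| <= N * rho ^+ 2.
  have -> : M + MF + `|c| = (M + MF + `|c|) / rho ^+ 2 * rho ^+ 2 by rewrite divfK// gt_eqF.
  by rewrite ler_pM2r// /N; lra.
pose g z := u (z.1 + (m + a * clamp s2 z.2), clamp s2 z.2) - F (clamp s2 z.2) - N * (z.1 * z.1).
have cg : continuous g.
  have c1 := continuous_clamp s20 s2T cu.
  have ccl : continuous (fun z : R * R => clamp s2 z.2).
    apply: (@continuous_clamp_fun R id s2 _ s20) => e e0; exists e => // s t _ st _ h.
    by rewrite ger0_norm ?subr_ge0// ltW.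
  have c2 : continuous (fun z : R * R => z.1 + (m + a * clamp s2 z.2)).
    move=> z; apply: cvgD; first exact: continuous2_fst.
    apply: cvgD; first exact: cvg_cst.
    by apply: cvgM; [exact: cvg_cst|exact: ccl].
  have c3 := continuous2_comp c1 c2 continuous2_snd.
  have c4 : continuous (fun z : R * R => F (clamp s2 z.2)).
    by apply: (continuous_Rint_clamp ib s20); exact: ltW.
  move=> z; apply: cvgB; first by apply: cvgB; [exact: c3|exact: c4].
  by apply: cvgM; [exact: cvg_cst|apply: cvgM; exact: continuous2_fst].
have gE y t : 0 <= t -> t <= s2 -> g (y, t) = u (y + (m + a * t), t) - F t - N * (y * y).
  by move=> t0 tt; rewrite /g /= clamp_id.
have [||||||sg [la [xs [ts [sg0 la0 xsr /andP[ts0 ts2] HM]]]]] :=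
    @box_max R g rho s0 s1 s2 c 0 cg.
- by rewrite normr0 ltW.
- exact: ltW.
- exact: s12.
- move=> y yr; rewrite gE ?s00 ?(ltW (lt_trans s01 s12))//.
  have s02 : s0 <= s0 <= s2 by rewrite lexx ltW// (lt_trans s01).
  have [_ r1] : Om (y + (m + a * s0)) /\ `|y + (m + a * s0)| <= r by apply: tube s02 _; rewrite addrK.
  have [_ r2] : Om (m + a * s0) /\ `|m + a * s0| <= r by apply: tube s02 _; rewrite subrr normr0 ltW.
  have := lipu s0 _ _ s00 (lt_trans s01 (lt_trans s12 s2T)) r1 r2.
  rewrite addrK => h; have := NL y; have := le_trans (ler_norm _) h.
  rewrite /c /rhs; clear; lra.
- move=> y t yr /andP[t0 tt]; rewrite (gE y t (le_trans s00 t0) tt).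
  have -> : y * y = rho ^+ 2 by rewrite -yr expr2 -normrM ger0_norm// -expr2 sqr_ge0.
  have := uM (y + (m + a * t)) t; have := FM t; have := ler_norm (- c); rewrite normrN.
  have t0' : 0 <= t := le_trans s00 t0.
  have tT : t < T := le_lt_trans tt s2T.
  move=> h1 /(_ t0' tt) h2 /(_ t0' tT) h3; move: h1 h2 h3 Nrho; rewrite /c !ler_norml; clear; lra.
- rewrite (gE 0 s1 (le_trans s00 (ltW s01)) (ltW s12)) add0r !mulr0 subr0 -/lhs /c /ga.
  move: gap; clear; lra.
have ts0' : 0 <= ts := le_trans s00 (ltW ts0).
have tsT : ts < T := lt_trans ts2 s2T.
pose X := xs + (m + a * ts).
have tsI : s0 <= ts <= s2 by rewrite !ltW.
(* The maximum is at least the value at the centre of the tube, at the same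
   time. *)
have NX : N * `|xs| <= L.
  have [->|xs0] := eqVneq xs 0; first by rewrite normr0 mulr0.
  have := HM 0 ts; rewrite normr0 (ltW rho0) tsI => /(_ isT isT).
  rewrite !gE// ?(ltW ts2)// add0r !mulr0 subr0.
  have [_ r1] : Om X /\ `|X| <= r by apply: tube tsI _; rewrite addrK ltW.
  have [_ r2] : Om (m + a * ts) /\ `|m + a * ts| <= r by apply: tube tsI _; rewrite subrr normr0 ltW.
  have := le_trans (ler_norm _) (lipu ts _ _ ts0' tsT r1 r2).
  rewrite /X addrK (_ : barrier sg la s1 (0, ts) = barrier sg la s1 (xs, ts))// => h1 h2.
  have xs0' : 0 < `|xs| by rewrite normr_gt0.
  rewrite -(ler_pM2r xs0') -mulrA -normrM ger0_norm -?expr2 ?sqr_ge0//.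
  move: h1 h2; clear; lra.
pose dd := Num.min (Num.min (ts - s0) (s2 - ts)) ((rho - `|xs|) / (1 + `|a|)).
have a10 : 0 < 1 + `|a| by rewrite ltr_pwDl.
have dd0 : 0 < dd by rewrite !lt_min !subr_gt0 ts0 ts2 divr_gt0// subr_gt0.
have inbox y t : `|y - X| <= dd -> `|t - ts| <= dd ->
    s0 <= t <= s2 /\ `|y - (m + a * t)| <= rho.
  rewrite /dd !le_min => /andP[/andP[y1 y2] y3] /andP[/andP[t1 t2] t3].
  split; first by move: t1 t2; rewrite !ler_norml; clear; lra.
  have -> : y - (m + a * t) = xs + ((y - X) - a * (t - ts)) by rewrite /X; ring.
  rewrite (le_trans (ler_normD _ _))// -lerBrDl (le_trans (ler_normB _ _))//.
  rewrite normrM; move: y3 t3; rewrite !ler_pdivlMr// => y3 t3.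
  have := ler_wpM2l (normr_ge0 a) t3 => t4.
  rewrite -(ler_pM2r a10) mulrDl (mulrC _ (1 + `|a|)).
  have e1 : (1 + `|a|) * `|y - X| <= rho - `|xs| by rewrite mulrC.
  have -> : (rho - `|xs|) * (1 + `|a|) = (rho - `|xs|) + `|a| * (rho - `|xs|) by clear; ring.
  by rewrite lerD// -mulrA.
have inX : s0 <= ts <= s2 /\ `|X - (m + a * ts)| <= rho by split => //; rewrite addrK ltW.
have [OX _] := tube X ts inX.1 inX.2.
have C := C1planeD (C1plane_parabola a m N) (C1plane_barrier sg la s1).
have loc : let w z := u z - (\int[leb R]_(s in `]0, z.2[) b s + (parabola a m N z + barrier sg la s1 z)) in
   \forall z \near (X, ts), 0 < z.2 -> z.2 < T -> w z <= w (X, ts).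
  move=> w; apply/nbhs2P; exists dd => // -[y t] /= h1 h2 _ _.
  have [t02 yr] := inbox y t (ltW h1) (ltW h2).
  have := HM _ _ yr t02; have /andP[t0 t2] := t02.
  rewrite !gE// ?(le_trans s00)// ?(ltW ts2)// subrK -/X /w /parabola /= -!/(F _) /barrier /=.
  by rewrite (_ : X - (m + a * ts) = xs) ?addrK//; clear; lra.
have := sol b _ _ _ X ts ib C OX (le_lt_trans s00 ts0) tsT loc; rewrite /interior_condition.
move=> /(_ (fun q : R * R * R => a * q.2)) h.
have := barrier_t_gt0 s1 (X, ts) sg0 la0; rewrite ltNge => /negP; apply.
apply: (le_trans _ (h _ _)).
- by rewrite /= addr0; clear; lra.
- apply: continuous_subspaceT => z; apply: cvgM; first exact: cvg_cst.
  exact: cvg_snd.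
- exists (Num.min dd 1); first by rewrite lt_min dd0 /=.
  apply: aeW => t _; rewrite le_min => /andP[t1 t2] y p Oy; rewrite 2!(le_min _ dd) => /andP[y1 y2] /andP[p1 p2].
  have [t02 yr] := inbox y t y1 t1.
  rewrite addrC; apply: Hle => //.
  move: p2; rewrite /= addr0 /X addrK => p2.
  have := ler_normD (p - 2 * N * xs) (2 * N * xs); rewrite subrK.
  rewrite !normrM (ger0_norm (ltW N0)) ger0_norm//.
  move: p2 NX; clear; lra.
Qed.

(** With a kink K |x| steeper than u, the difference u - K |x| is maximal over
    the junction. The choice b = - A makes G_0 = 0 admissible, since the
    junction Hamiltonian is at least A, whatever the slopes. *)
Lemma le_along_junction T H1 H2 ph1 ph2 (A : R -> R) u (M L s0 s1 : R) :
  FLtm_subsolution T H1 H2 ph1 ph2 A u ->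
  {within [set: R] `*` `[0, T[, continuous u} ->
  (forall x t, 0 <= t -> t < T -> `|u (x, t)| <= M) ->
  0 <= L -> x_lipschitz_on T u 1 L -> L1 T A ->
  0 <= s0 -> s0 < s1 -> s1 < T ->
  u (0, s1) + \int[leb R]_(s in `]0, s1[) A s <=
  u (0, s0) + \int[leb R]_(s in `]0, s0[) A s.
Proof.
move=> sol cu uM L0 lipu iA s00 s01 s1T.
have ib := L1N iA.
set b := (fun s => - A s) in ib.
pose F := fun t => \int[leb R]_(s in `]0, t[) b s.
have Fopp t : t <= T -> \int[leb R]_(s in `]0, t[) A s = - F t.
  by move=> tT; rewrite /F (Rint_opp tT iA) opprK.
rewrite !Fopp ?(ltW s1T) ?(ltW (lt_trans s01 s1T))//.
pose s2 := (s1 + T) / 2.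
have s12 : s1 < s2 by move: s1T; rewrite /s2; clear; lra.
have s2T : s2 < T by move: s1T; rewrite /s2; clear; lra.
rewrite leNgt; apply/negP => gap.
set rhs := u (0, s0) - F s0 in gap.
set lhs := u (0, s1) - F s1 in gap.
pose ga := lhs - rhs; have ga0 : 0 < ga by rewrite subr_gt0.
pose c := rhs + ga / 2.
pose MF := \int[leb R]_(s in `]0, T[) `|b s|.
have s20 : 0 <= s2 := le_trans s00 (ltW (lt_trans s01 s12)).
have FM t : 0 <= t -> t <= s2 -> `|F t| <= MF.
  by move=> t0 tt; apply: Rint_norm_le => //; exact: le_trans (ltW s2T).
pose K := M + MF + `|c| + L + 1.
have M0 : 0 <= M by apply: le_trans (uM 0 s1 (le_trans s00 (ltW s01)) s1T); rewrite normr_ge0.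
have MF0 : 0 <= MF by apply: Rintegral_ge0 => *; exact: normr_ge0.
have c0 : 0 <= `|c| := normr_ge0 c.
have KL : L < K by rewrite /K; move: M0 MF0 c0; clear; lra.
pose g z := u (z.1, clamp s2 z.2) - F (clamp s2 z.2) - K * `|z.1|.
have cg : continuous g.
  have c1 := continuous_clamp s20 s2T cu.
  have c4 : continuous (fun z : R * R => F (clamp s2 z.2)).
    by apply: (continuous_Rint_clamp ib s20); exact: ltW.
  move=> z; apply: cvgB; first by apply: cvgB; [exact: c1|exact: c4].
  by apply: cvgM; [exact: cvg_cst|apply: cvg_norm; exact: continuous2_fst].
have gE y t : 0 <= t -> t <= s2 -> g (y, t) = u (y, t) - F t - K * `|y|.
  by move=> t0 tt; rewrite /g /= clamp_id.
have [||||||sg [la [xs [ts [sg0 la0 xsr /andP[ts0 ts2] HM]]]]] :=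
    @box_max R g 1 s0 s1 s2 c 0 cg.
- by rewrite normr0.
- exact: ltW.
- exact: s12.
- move=> y yr; rewrite (gE y s0 s00 (ltW (lt_trans s01 s12))).
  have := lipu s0 y 0 s00 (lt_trans s01 s1T) yr.
  rewrite normr0 ler01 => /(_ isT) /(le_trans (ler_norm _)); rewrite subr0 => h.
  have : L * `|y| <= K * `|y| by rewrite ler_wpM2r// ltW.
  move: h ga0; rewrite /c /rhs; clear; lra.
- move=> y t yr /andP[t0 tt]; rewrite (gE y t (le_trans s00 t0) tt) yr mulr1.
  have t0' : 0 <= t := le_trans s00 t0.
  have tT : t < T := le_lt_trans tt s2T.
  have := uM y t t0' tT; have := FM t t0' tt; have := ler_norm (- c); rewrite normrN.
  by rewrite !ler_norml /K; move: L0; clear; lra.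
- rewrite (gE 0 s1 (le_trans s00 (ltW s01)) (ltW s12)) normr0 mulr0 subr0 -/lhs /c /ga.
  move: gap; clear; lra.
have ts0' : 0 <= ts := le_trans s00 (ltW ts0).
have tsT : ts < T := lt_trans ts2 s2T.
have tsI : s0 <= ts <= s2 by rewrite !ltW.
have xsE : xs = 0.
  apply/eqP; rewrite -normr_le0 leNgt; apply/negP => xs0.
  have := HM 0 ts; rewrite normr0 ler01 tsI => /(_ isT isT).
  rewrite !gE// ?(ltW ts2)// normr0 mulr0 subr0.
  have := lipu ts xs 0 ts0' tsT (ltW xsr); rewrite normr0 ler01 subr0 => /(_ isT).
  move=> /(le_trans (ler_norm _)).
  rewrite (_ : barrier sg la s1 (0, ts) = barrier sg la s1 (xs, ts))//.
  have : L * `|xs| < K * `|xs| by rewrite ltr_pM2r.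
  clear; lra.
rewrite {}xsE in xsr HM.
have C1 := C1planeD (C1plane_linform K 0) (C1plane_barrier sg la s1).
have C2 := C1planeD (C1plane_linform (- K) 0) (C1plane_barrier sg la s1).
have [| |S _ _] := FLtm_test sol ib C1 C2 _ (le_lt_trans s00 ts0) tsT (x0 := 0).
- by move=> t; rewrite /linform /= !mulr0.
- move=> w; apply/nbhs2P; exists (Num.min 1 (Num.min (ts - s0) (s2 - ts))).
    by rewrite !lt_min ltr01 !subr_gt0 ts0.
  move=> -[y t] /=; rewrite !lt_min subr0 => /and3P[y1 _ _] /and3P[_ t1 t2] _ _.
  have t02 : s0 <= t <= s2 by move: t1 t2; rewrite !ltr_norml; clear; lra.
  have := HM _ _ (ltW y1) t02; have /andP[t0 t2'] := t02.
  rewrite !gE// ?(le_trans s00)// ?(ltW ts2)//.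
  rewrite /w -!/(F _) /glue /linform /= lexx normr0 mulr0 !mul0r.
  case: (leP 0 y) => y0; [rewrite ger0_norm//|rewrite ltr0_norm//]; clear; lra.
have h := S erefl (fun=> 0).
have := barrier_t_gt0 s1 (0, ts) sg0 la0; rewrite ltNge => /negP; apply.
apply: (le_trans _ (h _ _)).
- by rewrite add0r addr0.
- by apply: continuous_subspaceT => z; exact: cvg_cst.
- exists 1 => //; apply: aeW => t _ _ x1 x2 q1 q2 _ _ _ _ _ _.
  by rewrite addr0 /b opprK le_max lexx.
Qed.

End subsolutions.

(** * The smoothed subsolution is a classical subsolution *)

Section smoothing_subsolutions.
Context {R : realType}.
Implicit Types (f g : R * R -> R) (w u : R * R -> R) (z : R * R) (x t e d a T : R).

Lemma uniformly_continuous_itv (g : R -> R) T e : continuous g -> 0 < e ->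
  exists2 d : R, 0 < d & forall t s, 0 <= t <= T -> `|t - s| <= d -> `|g s - g t| <= e.
Proof.
move=> cg e0.
have cw : continuous (fun z : R * R => g z.1).
  by move=> z; apply: (@continuous_comp _ _ _ (fun z : R * R => z.1) g); [exact: continuous2_fst|exact: cg].
have [d d0 H] := uniformly_continuous_box T cw e0.
exists d => // t s /andP[t0 tT] ts; apply: (H (t, 0) (s, 0)) => /=.
- by rewrite ger0_norm.
- by rewrite normr0 (le_trans t0).
- by rewrite distrC.
- by rewrite subrr normr0 ltW.
Qed.

(** A function of time that is merely L^1 varies between close times by at
    most an L^1 error at each of the two times. *)
Lemma L1_near_continuous T (h : R -> R) (s e : R) : 0 < T -> L1 T h -> 0 < s -> 0 < e ->
  exists (g : R -> R) d, [/\ L1 T (fun t => `|h t - g t|), 0 < d,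
    \int[leb R]_(t in `]0, T[) `|h t - g t| <= s &
    forall t r, 0 <= t <= T -> `|t - r| <= d -> `|h r - h t| <= `|h t - g t| + `|h r - g r| + e].
Proof.
move=> T0 hi s0 e0.
have [g cg Hg] := L1_dense T0 hi s0.
have [d d0 Hd] := uniformly_continuous_itv T cg e0.
exists g, d; split => //.
- by apply: L1_norm; apply: L1D => //; apply: L1N; exact: L1_continuous.
- exact: ltW.
- move=> t r tT tr; have := Hd t r tT tr.
  have -> : h r - h t = (h r - g r) + ((g r - g t) - (h t - g t)) by clear; ring.
  move=> h1; have h2 := ler_normD (h r - g r) ((g r - g t) - (h t - g t)).
  have h3 := ler_normB (g r - g t) (h t - g t).
  move: h1 h2 h3; clear; lra.
Qed.

(** All oscillations in time are dominated by k (t) + k (r) + e for a single k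
    of small integral. Because k is evaluated at the two times separately, its
    average over [t, t + d] is the derivative of a smoothed primitive and
    needs no differentiation theorem. *)
Lemma exists_time_modulus T (h A : R -> R) (om : R -> R -> R) (s e : R) : 0 < T ->
  Linfty T h -> Linfty T A -> t_integrable_modulus T om -> 0 < s -> 0 < e ->
  exists k eps d, [/\ L1 T k, \int[leb R]_(t in `]0, T[) k t <= s,
    forall t, 0 <= t <= T -> 0 <= k t, 0 < eps /\ 0 < d &
    forall t r y, 0 <= t <= T -> 0 <= r <= T -> `|t - r| <= d -> 0 <= y <= eps ->
      `|h r - h t| + om t y + om r y <= k t + k r + e /\
      A t - A r <= k t + k r + e].
Proof.
move=> T0 hh AA [[om0 om1 om2 om3 om4] omc] s0 e0.
have s30 : 0 < s / 3 by rewrite divr_gt0.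
have [gh [dh [ih dh0 sh Hh]]] := L1_near_continuous T0 (Linfty_L1 hh) s30 e0.
have [gA [dA [iA dA0 sA HA]]] := L1_near_continuous T0 (Linfty_L1 AA) s30 e0.
have [eps eps0 Heps] : exists2 eps : R, 0 < eps &
    \int[leb R]_(t in `]0, T[) om t eps <= s / 3.
  move/cvgrPdist_lt : omc => /(_ _ s30).
  rewrite near_withinE => /nbhs_ballP[r /= r0 Hr].
  exists (r / 2); first by rewrite divr_gt0.
  have : `|0 - \int[leb R]_(t in `]0, T[) om t (r / 2)| < s / 3.
    apply: Hr; last by rewrite divr_gt0.
    by rewrite /ball/= sub0r normrN gtr0_norm ?divr_gt0//; move: r0; clear; lra.
  by rewrite sub0r normrN => /ltW; apply: le_trans; exact: ler_norm.
have io := om3 _ (ltW eps0).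
have i1 := L1D iA io.
exists (fun t => `|h t - gh t| + (`|A t - gA t| + om t eps)), eps, (Num.min dh dA).
split.
- exact: L1D.
- rewrite (Rint_add (lexx T) ih i1) (Rint_add (lexx T) iA io).
  by move: sh sA Heps; clear; lra.
- by move=> t tT; rewrite !addr_ge0// om0// ltW.
- by rewrite lt_min dh0.
- move=> t r y tT rT; rewrite le_min => /andP[d1 d2] /andP[y0 ye].
  have := Hh t r tT d1; have := HA t r tT d2.
  have tT' : t \in `[0, T] by rewrite in_itv.
  have rT' : r \in `[0, T] by rewrite in_itv.
  have [_ _ /(_ y eps y0 ye) m1] := om1 t tT'.
  have [_ _ /(_ y eps y0 ye) m2] := om1 r rT'.
  have p1 := om0 t eps tT' (ltW eps0); have p2 := om0 r eps rT' (ltW eps0).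
  have q1 := normr_ge0 (h t - gh t); have q2 := normr_ge0 (h r - gh r).
  have q3 := normr_ge0 (A t - gA t); have q4 := normr_ge0 (A r - gA r).
  have q5 := ler_norm (A t - A r); rewrite distrC in q5.
  move: m1 m2 p1 p2 q1 q2 q3 q4 q5; clear; split; lra.
Qed.

(** Subtracting the primitive of k makes room for the term k (r) of the
    oscillation bound before averaging. *)
Definition corrected u (k : R -> R) t3 z :=
  u (z.1, clamp t3 z.2) - \int[leb R]_(s in `]0, (clamp t3 z.2)[) k s.

Lemma continuous_corrected T u k t3 : 0 <= t3 -> t3 < T -> L1 T k ->
  {within [set: R] `*` `[0, T[, continuous u} -> continuous (corrected u k t3).
Proof.
move=> t30 t3T ik cu z; apply: cvgB; first exact: (continuous_clamp t30 t3T cu).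
by apply: (continuous_Rint_clamp ik t30); exact: ltW.
Qed.

Lemma between_lt0 t d s : 0 <= d -> between t (t + d) s -> t <= s <= t + d.
Proof. by move=> d0; rewrite /between min_l ?max_r ?lerDl. Qed.

(** At the given point, let p0 be the slope of the smoothed function and a a
    subgradient of H t x at p0. Then a p - k (s) - C <= H s y p for all (s, y)
    close to (t, x), where C = a p0 - H t x p0 + k (t) + eta; so w grows at
    most like C tau along the direction (a, 1), and so do its averages. In the
    resulting bound on psi_t + a psi_x the terms a p0 cancel. *)
Lemma smooth_interior_subsolution T Om H u k (M r L t3 eta e d x t rho0 : R) :
  interior_subsolution T Om H u ->
  {within [set: R] `*` `[0, T[, continuous u} ->
  (forall x t, 0 <= t -> t < T -> `|u (x, t)| <= M) ->
  0 <= L -> x_lipschitz_on T u r L -> L1 T k ->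
  (forall t s x y p, 0 <= t <= T -> 0 <= s <= T -> `|t - s| <= 2 * d ->
     `|x| <= r -> `|y| <= r -> `|x - y| <= 2 * `|e| -> `|p| <= 2 * L + 1 ->
     H t x p - H s y p <= k t + k s + eta) ->
  (forall t, 0 <= t <= T -> convex_function [set: convex_lmodType R^o] (H t x)) ->
  e != 0 -> 0 < d -> 0 < t -> t + 2 * d <= t3 -> t3 < T -> `|x| + 2 * `|e| <= r ->
  0 < rho0 -> (forall y y', between x (x + e) y -> `|y' - y| <= rho0 -> Om y') ->
  smooth_t e d (corrected u k t3) (x, t)
    + H t x (smooth_x e d (corrected u k t3) (x, t)) <= k t + eta + d^-1 * (2 * (L * `|e|)).
Proof.
move=> sol cu uM L0 lipu ik Hclose Hconv e0 d0 t0 tt3 t3T xr rho00 nbOm.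
set w := corrected u k t3.
have t30 : 0 <= t3 by move: t0 d0 tt3; clear; lra.
have cw : continuous w by exact: (continuous_corrected t30 t3T ik cu).
have ae0 : 0 < `|e| by rewrite normr_gt0.
have wlip y1 y2 s : `|y1| <= r -> `|y2| <= r -> `|w (y1, s) - w (y2, s)| <= L * `|y1 - y2|.
  move=> h1 h2; rewrite /w /corrected /= opprB addrA subrK.
  have /andP[c1 c2] := clamp_itv s t30.
  by apply: lipu => //; exact: le_lt_trans t3T.
have xr' : `|x| <= r by move: ae0 xr; clear; lra.
have xer y : between x (x + e) y -> `|y| <= `|x| + `|e|.
  move=> /between_dist h; rewrite -(subrK x y) (le_trans (ler_normD _ _))// addrC lerD2l//.
have p0L : `|smooth_x e d w (x, t)| <= L.
  apply: smooth_x_le => //; first by rewrite gt_eqF.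
  move=> s _; rewrite (le_trans (wlip _ _ _ _ _))//.
    by rewrite (le_trans (ler_normD _ _))//; move: ae0 xr; clear; lra.
  by rewrite (addrC x) addrK.
set p0 := smooth_x e d w (x, t) in p0L *.
have tT : 0 <= t <= T by move: t0 d0 tt3 t3T; clear; lra.
have [a Ha] := exists_subgradient p0 (Hconv t tT).
(* The constant part of the source of the transport inequality. *)
pose C := a * p0 - H t x p0 + k t + eta.
suff: smooth_t e d w (x, t) + a * p0 <= C + d^-1 * (2 * (L * `|e|)).
  by rewrite /C; clear; lra.
pose m0 := Num.min rho0 `|e|.
have m00 : 0 < m0 by rewrite lt_min rho00.
have a10 : 0 < `|a| + 1 by rewrite ltr_wpDl.
(* Lines of slope a starting between x and x + e must stay for a time 2 tau in
   Om and within 2 |e| of x. *)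
pose r0 := Num.min (d / 2) (m0 / (4 * (`|a| + 1))).
have r00 : 0 < r0 by rewrite lt_min !divr_gt0// mulr_gt0.
apply: (smooth_subsolution (r := r0)) => //.
  move=> y s _ yb; rewrite (le_trans (wlip _ _ _ _ _))//.
  - have := between_dist yb; rewrite subr0 => h; rewrite (le_trans h)//.
    by have := normr_ge0 x; move: ae0 xr; clear; lra.
  - by rewrite normr0; have := normr_ge0 x; move: ae0 xr; clear; lra.
  - by rewrite ler_wpM2l//; exact: (between_dist yb).
move=> y s tau sb yb /andP[tau0]; rewrite lt_min => /andP[taud].
rewrite ltr_pdivlMr ?mulr_gt0// => taum.
have /andP[ts std] := between_lt0 (ltW d0) sb.
have ik' := L1D ik (L1_cst T C).
have s0 : 0 <= s := le_trans (ltW t0) ts.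
have s1 : s < s + tau by rewrite ltrDl.
have s2 : s + tau < s + 2 * tau by move: tau0; clear; lra.
have s2t3 : s + 2 * tau <= t3 by move: std tt3 taud; clear; lra.
have s2T : s + 2 * tau < T := le_lt_trans s2t3 t3T.
have rho1 : 0 < m0 / 2 by rewrite divr_gt0.
have am : `|a| * (2 * tau) <= m0 / 2.
  have : `|a| * tau <= (`|a| + 1) * tau by rewrite ler_pM2r// lerDl.
  by move: taum; clear; lra.
have tube y' s' : s <= s' <= s + 2 * tau -> `|y' - (y - a * s + a * s')| <= m0 / 2 ->
    [/\ `|y' - y| <= m0, Om y', `|y'| <= r & `|x - y'| <= 2 * `|e|].
  move=> /andP[ss' s't] h.
  have h1 : `|y' - y| <= m0.
    have -> : y' - y = (y' - (y - a * s + a * s')) + a * (s' - s) by clear; ring.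
    rewrite (le_trans (ler_normD _ _))// (splitr m0) lerD// (le_trans _ am)// normrM.
    by rewrite ler_wpM2l// ger0_norm ?subr_ge0//; move: s't; clear; lra.
  have /andP[h2 h3] : (`|y' - y| <= rho0) && (`|y' - y| <= `|e|) by rewrite -le_min.
  split; [exact: h1|exact: (nbOm _ _ yb h2)| |].
    rewrite -(subrK y y') (le_trans (ler_normD _ _))//.
    by have := xer _ yb; move: h3 xr; clear; lra.
  rewrite distrC; have := ler_distD y y' x; have := between_dist yb.
  by move: h3; clear; lra.
have Hle y' s' p : s <= s' <= s + 2 * tau -> `|y' - (y - a * s + a * s')| <= m0 / 2 ->
    `|p| <= 2 * L + 1 -> a * p - (k s' + C) <= H s' y' p.
  move=> s'b y'b pL; have [_ _ y'r xy'] := tube _ _ s'b y'b.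
  have /andP[ss' s't] := s'b.
  have s'T : 0 <= s' <= T.
    by rewrite (le_trans s0 ss') (le_trans s't)// ltW.
  have tts' : `|t - s'| <= 2 * d.
    by rewrite distrC ger0_norm; move: ts std ss' s't taud; clear; lra.
  have := Hclose t s' x y' p tT s'T tts' xr' y'r xy' pL.
  have := Ha p; rewrite /C mulrBr; clear; lra.
have := le_along_transport sol cu uM L0 lipu ik' s0 s1 s2 s2T rho1 (m := y - a * s) (a := a).
move=> /(_ (fun y' s' s'b y'b => let: And4 _ p1 p2 _ := tube y' s' s'b y'b in conj p1 p2) Hle).
have st3 : s + tau <= t3 := le_trans (ltW s2) s2t3.
have stT : s + tau <= T := le_trans st3 (ltW t3T).
have st0 : 0 <= s + tau := le_trans s0 (ltW s1).
rewrite (Rint_addc _ st0 stT ik) (Rint_addc _ s0 (le_trans (ltW s1) stT) ik).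
rewrite /w /corrected /= !clamp_id// ?(le_trans (ltW s1))//.
have -> : y - a * s + a * (s + tau) = y + a * tau by clear; ring.
have -> : y - a * s + a * s = y by clear; ring.
clear; lra.
Qed.

(** The time average of u (0, .) has derivative (u (0, t + d) - u (0, t)) / d,
    at most minus the average of A over [t, t + d]; the oscillation bound
    compares it with A (t). *)
Lemma smooth_junction_subsolution T H1 H2 ph1 ph2 (A : R -> R) u k (M L t3 eta e d t : R) :
  FLtm_subsolution T H1 H2 ph1 ph2 A u ->
  {within [set: R] `*` `[0, T[, continuous u} ->
  (forall x t, 0 <= t -> t < T -> `|u (x, t)| <= M) ->
  0 <= L -> x_lipschitz_on T u 1 L -> L1 T k -> L1 T A ->
  (forall t s, 0 <= t <= T -> 0 <= s <= T -> `|t - s| <= d -> A t - A s <= k t + k s + eta) ->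
  0 < d -> 0 < t -> t + d <= t3 -> t3 < T ->
  smooth_t e d (corrected u k t3) (0, t) + A t <= k t + eta.
Proof.
move=> sol cu uM L0 lipu ik iA Hclose d0 t0 tt3 t3T.
have ttd : t < t + d by rewrite ltrDl.
have tdT : t + d < T := le_lt_trans tt3 t3T.
have J := le_along_junction sol cu uM L0 lipu iA (ltW t0) ttd tdT.
rewrite smooth_t0 /corrected /= !clamp_id// ?(ltW t0) ?(ltW (lt_trans t0 ttd))//; last first.
  exact: le_trans (ltW ttd) tt3.
have iAk := L1D iA ik.
have ic := L1D iAk (L1_cst T (- (A t - k t - eta))).
have tT : 0 <= t <= T by rewrite (ltW t0) (ltW (lt_trans ttd tdT)).
have Hp s : 0 < s -> t <= s -> s < t + d -> 0 <= A s + k s + - (A t - k t - eta).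
  move=> s0 ts st; have sT : 0 <= s <= T by rewrite (ltW s0) (ltW (lt_trans st tdT)).
  have : `|t - s| <= d by rewrite distrC ger0_norm ?subr_ge0//; move: st; clear; lra.
  by move=> /(Hclose t s tT sT); clear; lra.
have := Rint_le (ltW t0) (ltW ttd) (ltW tdT) ic Hp.
have /andP[_ tT'] := tT.
rewrite !(Rint_addc _ _ _ iAk) ?(ltW t0) ?(ltW tdT) ?(ltW (lt_trans t0 ttd))//.
rewrite !(Rint_add _ iA ik) ?(ltW tdT)//.
move=> Hm; rewrite -lerBrDr ler_pdivrMl//.
move: J Hm; clear; lra.
Qed.

End smoothing_subsolutions.

(** * Touching a supersolution with a strict classical subsolution *)

Section comparison_tools.
Context {R : realType}.
Implicit Types (f g : R * R -> R) (w u : R * R -> R) (z : R * R) (x t e d a T : R).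

Lemma pmin_le T H ph t x p : @is_argmin R T H ph -> t \in `[0, T] -> pmin H t x <= H t x p.
Proof.
move=> am tT; apply: ge_inf; last by exists p.
by exists (H t x (ph t x)) => _ [q _ <-]; exact: am.
Qed.

Lemma Hminus_le T H ph t x p : @is_argmin R T H ph -> t \in `[0, T] -> Hminus H ph t x p <= H t x p.
Proof. by move=> am tT; rewrite /Hminus; case: ifP => _ //; exact: pmin_le am tT. Qed.

Lemma Hplus_le T H ph t x p : @is_argmin R T H ph -> t \in `[0, T] -> Hplus H ph t x p <= H t x p.
Proof. by move=> am tT; rewrite /Hplus; case: ifP => _ //; exact: pmin_le am tT. Qed.

Lemma continuous_comp_fst (X Y Z : topologicalType) (f : X -> Y * Z) :
  continuous f -> continuous (fun p => (f p).1).
Proof. by move=> cf p; apply: (cvg_comp _ _ (cf p)); exact: cvg_fst. Qed.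

Lemma continuous_comp_snd (X Y Z : topologicalType) (f : X -> Y * Z) :
  continuous f -> continuous (fun p => (f p).2).
Proof. by move=> cf p; apply: (cvg_comp _ _ (cf p)); exact: cvg_snd. Qed.

(** The function eta2 + c |p - Px| - Pt is continuous and, added to k,
    dominates H: this is the classical inequality for P, extended to slopes
    other than Px by the Lipschitz bound. Its value at the contact slope
    contradicts the strict decrease eta. *)
Lemma no_touching_inside T (Om : set R) H (c : R) k (Px Pt : R * R -> R) (x0 t0 pt p0 d eta eta2 kap : R) :
  continuous Px -> continuous Pt ->
  (forall t x p q, t \in `[0, T] -> `|H t x p - H t x q| <= c * `|p - q|) ->
  0 <= c -> 0 < d ->
  (forall x t, Om x -> `|x - x0| <= d -> `|t - t0| <= d ->
    Pt (x, t) + H t x (Px (x, t)) <= k t + eta2) ->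
  interior_condition (fun a b => a >= b) T Om H (fun s => - k s) x0 t0 pt p0 ->
  `|p0 - Px (x0, t0)| <= kap -> pt <= Pt (x0, t0) - eta -> eta2 + c * kap < eta -> False.
Proof.
move=> cPx cPt Hlip c0 d0 ineq IC p0k ptle.
pose G (q : R * R * R) := eta2 + c * `|q.2 - Px (q.1.2, q.1.1)| - Pt (q.1.2, q.1.1).
have cG : continuous G.
  have c1 : continuous (fun q : R * R * R => q.1) by move=> q; exact: cvg_fst.
  have c12 := continuous_comp_snd c1; have c11 := continuous_comp_fst c1.
  move=> q; apply: cvgB; last exact: (continuous2_comp cPt c12 c11).
  apply: cvgD; first exact: cvg_cst.
  apply: cvgM; first exact: cvg_cst.
  apply: cvg_norm; apply: cvgB; first exact: cvg_snd.
  exact: (continuous2_comp cPx c12 c11).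
have := IC G (continuous_subspaceT cG) _.
rewrite /G /= => h.
have : 0 <= pt + (eta2 + c * `|p0 - Px (x0, t0)| - Pt (x0, t0)).
  apply: h; exists d => //; apply: aeW => t tT tt0 x p Ox xx0 _.
  rewrite opprK; have := ineq x t Ox xx0 tt0; have := Hlip t x p (Px (x, t)) tT.
  move=> /(le_trans (ler_norm _)); clear; lra.
have : c * `|p0 - Px (x0, t0)| <= c * kap by rewrite ler_wpM2l.
move: ptle; clear; lra.
Qed.

(** The monotone parts are below the Hamiltonians themselves, so each of the
    three terms of the junction function is dominated by its own continuous
    function, and their maximum is an admissible G_0. *)
Lemma no_touching_at_junction T H1 H2 ph1 ph2 (A : R -> R) (c : R) k
    (P1x P1t P2x P2t : R * R -> R) (t0 pt p1 p2 d eta eta2 kap : R) :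
  continuous P1x -> continuous P1t -> continuous P2x -> continuous P2t ->
  is_argmin T H1 ph1 -> is_argmin T H2 ph2 ->
  (forall t x p q, t \in `[0, T] -> `|H1 t x p - H1 t x q| <= c * `|p - q|) ->
  (forall t x p q, t \in `[0, T] -> `|H2 t x p - H2 t x q| <= c * `|p - q|) ->
  0 <= c -> 0 < d ->
  (forall x t, 0 <= x -> `|x| <= d -> `|t - t0| <= d ->
    P1t (x, t) + H1 t x (P1x (x, t)) <= k t + eta2) ->
  (forall x t, x <= 0 -> `|x| <= d -> `|t - t0| <= d ->
    P2t (x, t) + H2 t x (P2x (x, t)) <= k t + eta2) ->
  (forall t, `|t - t0| <= d -> P1t (0, t) + A t <= k t + eta2) ->
  P2t (0, t0) = P1t (0, t0) ->
  junction_condition (fun a b => a >= b) T H1 H2 ph1 ph2 A (fun s => - k s) t0 pt p1 p2 ->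
  `|p1 - P1x (0, t0)| <= kap -> `|p2 - P2x (0, t0)| <= kap ->
  pt <= P1t (0, t0) - eta -> eta2 + c * kap < eta -> False.
Proof.
move=> c1x c1t c2x c2t am1 am2 Hl1 Hl2 c0 d0 ineq1 ineq2 ineqA P21 JC p1k p2k ptle sm.
have kap0 : 0 <= c * kap by rewrite mulr_ge0// (le_trans (normr_ge0 _) p1k).
pose G (q : R * R * R * (R * R)) :=
  Num.max (eta2 - P1t (0, q.1.1.1))
   (Num.max (eta2 + c * `|q.2.1 - P1x (q.1.1.2, q.1.1.1)| - P1t (q.1.1.2, q.1.1.1))
            (eta2 + c * `|q.2.2 - P2x (q.1.2, q.1.1.1)| - P2t (q.1.2, q.1.1.1))).
have cG : continuous G.
  have k1 : continuous (fun q : R * R * R * (R * R) => q.1) by move=> q; exact: cvg_fst.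
  have k2 : continuous (fun q : R * R * R * (R * R) => q.2) by move=> q; exact: cvg_snd.
  have k21 := continuous_comp_fst k2; have k22 := continuous_comp_snd k2.
  have k11 := continuous_comp_fst k1; have k12 := continuous_comp_snd k1.
  have k111 := continuous_comp_fst k11; have k112 := continuous_comp_snd k11.
  have side (Px Pt : R * R -> R) (pp xx : R * R * R * (R * R) -> R) : continuous Px -> continuous Pt ->
      continuous pp -> continuous xx ->
      continuous (fun q : R * R * R * (R * R) => eta2 + c * `|pp q - Px (xx q, q.1.1.1)| - Pt (xx q, q.1.1.1)).
    move=> cPx cPt cp cxx q; apply: cvgB; last exact: (continuous2_comp cPt cxx k111).
    apply: cvgD; first exact: cvg_cst.
    apply: cvgM; first exact: cvg_cst.
    apply: cvg_norm; apply: cvgB; first exact: cp.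
    exact: (continuous2_comp cPx cxx k111).
  have s1 := side _ _ _ _ c1x c1t k21 k112; have s2 := side _ _ _ _ c2x c2t k22 k12.
  have s0 : continuous (fun q : R * R * R * (R * R) => eta2 - P1t (0, q.1.1.1)).
    move=> q; apply: cvgB; first exact: cvg_cst.
    by apply: (continuous2_comp c1t (a := fun=> 0) _ k111) => y; exact: cvg_cst.
  move=> q; apply: (continuous_max (s0 q)).
  exact: (continuous_max (s1 q) (s2 q)).
have h := JC G (continuous_subspaceT cG) _.
have : 0 <= pt + G (t0, 0, 0, (p1, p2)).
  apply: h; exists d => //; apply: aeW => t tT tt0 x1 x2 q1 q2.
  rewrite !in_itv/= andbT => x10 x20 x1d x2d _ _; rewrite opprK.
  rewrite !ge_max -!lerBlDl; apply/and3P; split.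
  - apply: (@le_trans _ _ (eta2 - P1t (0, t))); last by rewrite /G /= le_max lexx.
    by have := ineqA t tt0; clear; lra.
  - apply: (@le_trans _ _ (eta2 + c * `|q1 - P1x (x1, t)| - P1t (x1, t))); last first.
      by rewrite /G /= !le_max lexx !orbT.
    have := ineq1 x1 t x10 x1d tt0; have := Hl1 t x1 q1 (P1x (x1, t)) tT.
    move=> /(le_trans (ler_norm _)); have := Hminus_le x1 q1 am1 tT; clear; lra.
  - apply: (@le_trans _ _ (eta2 + c * `|q2 - P2x (x2, t)| - P2t (x2, t))); last first.
      by rewrite /G /= !le_max lexx !orbT.
    have := ineq2 x2 t x20 x2d tt0; have := Hl2 t x2 q2 (P2x (x2, t)) tT.
    move=> /(le_trans (ler_norm _)); have := Hplus_le x2 q2 am2 tT; clear; lra.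
apply/negP; rewrite -ltNge -ltrBrDl sub0r /G /= P21 !gt_max.
have e1 : c * `|p1 - P1x (0, t0)| <= c * kap by rewrite ler_wpM2l.
have e2 : c * `|p2 - P2x (0, t0)| <= c * kap by rewrite ler_wpM2l.
by apply/and3P; split; move: ptle sm kap0 e1 e2; clear; lra.
Qed.

(** Extends the classical inequality for the smoothed subsolution, first known
    in the open half-line, to the junction point. *)
Lemma le_right_limit0 (Phi : R -> R) (C r : R) : continuous Phi -> 0 < r ->
  (forall x, 0 < x -> x <= r -> Phi x <= C) -> Phi 0 <= C.
Proof.
move=> cP r0 H; apply/ler_addgt0Pr => e e0.
have := cP 0 => /cvgrPdist_lt/(_ e e0)/nbhs_ballP[d /= d0 Hd].
pose x := Num.min (d / 2) r.
have x0 : 0 < x by rewrite lt_min divr_gt0.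
have : `|Phi 0 - Phi x| < e.
  apply: Hd; rewrite /ball/= sub0r normrN gtr0_norm//.
  by rewrite /x gt_min; apply/orP; left; move: d0; clear; lra.
have := H x x0; rewrite /x ge_min lexx orbT -/x => /(_ isT).
by rewrite ltr_norml; clear; lra.
Qed.

End comparison_tools.

Theorem theorem3p1 (R : realType) (T : R) (T_gt0 : 0 < T)
    (H1 H2 : R -> R -> R -> R)
    (H1_meas : measurable_continuous T H1) (H2_meas : measurable_continuous T H2)
    (H1_L1 : L1 T (fun t => H1 t 0 0)) (H2_L1 : L1 T (fun t => H2 t 0 0))
    (H1_x : x_regular T H1) (H2_x : x_regular T H2)
    (H1_p : p_lipschitz T H1) (H2_p : p_lipschitz T H2)
    (H1_convex : p_convex T H1) (H2_convex : p_convex T H2)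
    (H1_coercive : p_coercive T H1) (H2_coercive : p_coercive T H2)
    (H_t : t_regular T H1 H2)
    (phat1 phat2 : R -> R -> R)
    (phat1_min : is_argmin T H1 phat1) (phat2_min : is_argmin T H2 phat2)
    (A : R -> R) (A_Linfty : Linfty T A)
    (A_ge : {ae leb R, forall t : R, t \in `[0, T] ->
               A t >= Num.max (pmin H1 t 0) (pmin H2 t 0)})
    (u v : R * R -> R)
    (u_cont : {within [set: R] `*` `[0, T[, continuous u})
    (v_cont : {within [set: R] `*` `[0, T[, continuous v})
    (u_bounded : [bounded u z | z in [set: R] `*` `[0, T[])
    (v_bounded : [bounded v z | z in [set: R] `*` `[0, T[])
    (u_sub : FLtm_subsolution T H1 H2 phat1 phat2 A u)
    (v_super : FLtm_supersolution T H1 H2 phat1 phat2 A v)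
    (u_lip : x_locally_lipschitz T u) (v_lip : x_locally_lipschitz T v)
    (C1 C2 : R) (C1_gt0 : 0 < C1) (C2_gt0 : 0 < C2)
    (u_growth : forall x t : R, t \in `]0, T[ -> u (x, t) <= C1 * (1 + `|x|))
    (v_growth : forall x t : R, t \in `]0, T[ -> v (x, t) >= - C2 * (1 + `|x|))
    (uv0 : forall x : R, u (x, 0) <= v (x, 0)) :
  forall x t : R, t \in `]0, T[ -> u (x, t) <= v (x, t).
Proof.
have bnd (w : R * R -> R) : [bounded w z | z in [set: R] `*` `[0, T[] ->
    exists M : R, forall x t : R, 0 <= t -> t < T -> `|w (x, t)| <= M.
  move=> [M [Mr HM]]; exists (M + 1) => x t t0 tT; apply: (HM (M + 1)).
    by rewrite ltrDl.
  by split => //=; rewrite in_itv/= t0.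
have [Mu uM'] := bnd _ u_bounded; have [Mv vM'] := bnd _ v_bounded.
pose M := Num.max Mu Mv.
have uM x t : 0 <= t -> t < T -> `|u (x, t)| <= M.
  by move=> *; rewrite (le_trans (uM' _ _ _ _))// le_max lexx.
have vM x t : 0 <= t -> t < T -> `|v (x, t)| <= M.
  by move=> *; rewrite (le_trans (vM' _ _ _ _))// le_max lexx orbT.
move=> {bnd uM' vM'} x1 t1; rewrite in_itv/= => /andP[t10 t1T]; rewrite leNgt; apply/negP => gap.
have M0 : 0 <= M by rewrite (le_trans _ (uM 0 0 (lexx _) T_gt0)).
(* Sixteen times the margin leaves room for the smoothing error at two points,
   for int k and for the penalties. *)
pose sg := (u (x1, t1) - v (x1, t1)) / 16.
have sg0 : 0 < sg by rewrite divr_gt0// subr_gt0.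
have [c1 c10 Hc1] := H1_p; have [c2 c20 Hc2] := H2_p.
pose c := c1 + c2.
have c0 : 0 <= c by rewrite addr_ge0// ltW.
have Hl1 t x p q : t \in `[0, T] -> `|H1 t x p - H1 t x q| <= c * `|p - q|.
  by move=> tT; rewrite (le_trans (Hc1 _ _ _ _ tT))// ler_wpM2r// lerDl ltW.
have Hl2 t x p q : t \in `[0, T] -> `|H2 t x p - H2 t x q| <= c * `|p - q|.
  by move=> tT; rewrite (le_trans (Hc2 _ _ _ _ tT))// ler_wpM2r// lerDr ltW.
pose eta := sg / T.
have eta0 : 0 < eta by rewrite divr_gt0.
have etaT t : 0 <= t -> t <= T -> 0 <= eta * t <= sg.
  move=> t0 tT; rewrite mulr_ge0 ?(ltW eta0)//=.
  by rewrite /eta mulrAC ler_pdivrMr// ler_pM2l.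
pose eta1 := eta / 8.
have eta10 : 0 < eta1 by rewrite divr_gt0.
have c40 : 0 < 4 * (c + 1) by move: c0; clear; lra.
have x110 : 0 < 1 + `|x1| by rewrite ltr_pwDl.
pose kap := Num.min (sg / (1 + `|x1|)) (eta / (4 * (c + 1))).
have kap0 : 0 < kap by rewrite lt_min (divr_gt0 sg0 x110) (divr_gt0 eta0 c40).
have kapx1 : kap * `|x1| <= sg.
  have : kap <= sg / (1 + `|x1|) by rewrite ge_min lexx.
  by rewrite ler_pdivlMr// mulrDr mulr1; move: kap0; clear; lra.
have ckap : c * kap <= eta / 4.
  have : kap <= eta / (4 * (c + 1)) by rewrite ge_min lexx orbT.
  by rewrite ler_pdivlMr//; move: kap0; clear; lra.
(* Beyond R0 the penalty kap |x| exceeds the oscillation of u - v. *)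
pose R0 := `|x1| + 1 + 2 * M / kap.
have R00 : 0 < R0 by rewrite /R0 -addrA ltr_wpDl// ltr_pwDl// divr_ge0 ?mulr_ge0// ltW.
have R0x1 : `|x1| <= R0 by rewrite /R0 -addrA lerDl addr_ge0// divr_ge0 ?mulr_ge0// ltW.
have R0M : 2 * M <= kap * R0.
  rewrite /R0 mulrDr (mulrC kap (_ / _)) divfK ?gt_eqF// lerDr.
  by apply: mulr_ge0; [exact: ltW|exact: addr_ge0].
pose r := R0 + 3.
have r0 : 0 < r by move: R00; rewrite /r; clear; lra.
have [L0 HL0] := u_lip r r0.
pose L := `|L0|; have Lge0 : 0 <= L := normr_ge0 L0.
have lipu : x_lipschitz_on T u r L.
  move=> t x y t0 tT xr yr.
  have tI : t \in `[0, T[ by rewrite in_itv/= t0.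
  have := HL0 t tI (x, y) (conj xr yr) => /= h.
  by rewrite (le_trans h)// ler_wpM2r// ler_norm.
have lipu1 : x_lipschitz_on T u 1 L.
  move=> t x y t0 tT xr yr.
  by apply: lipu => //; [apply: le_trans xr _|apply: le_trans yr _]; rewrite /r; move: R00; clear; lra.
(* The slopes tested are bounded by 2 L + 1, hence a fixed compact set. *)
pose Q : set (R * R) := `[- r, r] `*` `[- (2 * L + 1), 2 * L + 1].
have cQ : compact Q by apply: compact_setX; exact: segment_compact.
have [h [om [hinf omint Hreg]]] := H_t Q cQ.
have [k [eps [dk [ik sk k0 [eps0 dk0] Hk]]]] :=
  exists_time_modulus T_gt0 hinf A_Linfty omint sg0 eta10.
have iA := Linfty_L1 A_Linfty.
pose t2 := (t1 + T) / 2.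
have t12 : t1 < t2 by move: t1T; rewrite /t2; clear; lra.
have t2T : t2 < T by move: t1T; rewrite /t2; clear; lra.
pose t3 := (t2 + T) / 2.
have t23 : t2 < t3 by move: t2T; rewrite /t3; clear; lra.
have t3T : t3 < T by move: t2T; rewrite /t3; clear; lra.
have t20 : 0 <= t2 := ltW (lt_trans t10 t12).
have t30 : 0 <= t3 := le_trans t20 (ltW t23).
pose w := corrected u k t3.
have cw : continuous w := continuous_corrected t30 t3T ik u_cont.
pose F t := \int[leb R]_(s in `]0, t[) k s.
have wE x t : 0 <= t -> t <= t3 -> w (x, t) = u (x, t) - F t.
  by move=> t0 tt; rewrite /w /corrected /= clamp_id.
have F0 t : 0 <= t -> t <= T -> 0 <= F t <= sg.
  move=> t0 tT; apply/andP; split.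
    by apply: Rintegral_ge0 => s; rewrite /= in_itv/= => /andP[s0 st]; apply: k0; rewrite ltW//= (le_trans (ltW st)).
  apply: (le_trans _ sk); apply: (Rint_le t0 tT (lexx T) ik) => s s0 _ sT.
  by apply: k0; rewrite !ltW.
have [dw dw0 Hdw] := uniformly_continuous_box (R0 + T) cw sg0.
pose d := Num.min (dk / 2) (Num.min dw ((t3 - t2) / 2)).
have d0 : 0 < d by rewrite !lt_min dw0 !divr_gt0// subr_gt0.
have [dk2 ddw dt] : [/\ d <= dk / 2, d <= dw & d <= (t3 - t2) / 2].
  by rewrite /d !ge_min !lexx !orbT.
have L10 : 0 < 2 * (L + 1) by move: Lge0; clear; lra.
(* The space scale e is chosen after the time scale d, so that L e / d is
   small. *)
pose e := Num.min 1 (Num.min (eps / 2) (Num.min (sg / (2 * (L + 1))) (eta1 * d / (2 * (L + 1))))).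
have e0 : 0 < e.
  by rewrite !lt_min ltr01 (divr_gt0 eps0)// (divr_gt0 sg0 L10) (divr_gt0 (mulr_gt0 eta10 d0) L10).
have [e1 eeps esg eeta] : [/\ e <= 1, e <= eps / 2, e <= sg / (2 * (L + 1)) & e <= eta1 * d / (2 * (L + 1))].
  by rewrite /e !ge_min !lexx !orbT.
have Le_sg : L * e <= sg / 2.
  by move: esg; rewrite ler_pdivlMr//; move: e0; clear; lra.
have Le_eta : d^-1 * (2 * (L * e)) <= eta1.
  rewrite ler_pdivrMl//; move: eeta; rewrite ler_pdivlMr//; move: e0; clear; lra.
have Hclose H : H = H1 \/ H = H2 -> forall t s x y p, 0 <= t <= T -> 0 <= s <= T ->
    `|t - s| <= 2 * d -> `|x| <= r -> `|y| <= r -> `|x - y| <= 2 * e -> `|p| <= 2 * L + 1 ->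
    H t x p - H s y p <= k t + k s + eta1.
  move=> H12 t s x y p tT sT ts xr yr xy pL.
  have Qx : Q (x, p) by split => /=; rewrite in_itv/= -ler_norml.
  have Qy : Q (y, p) by split => /=; rewrite in_itv/= -ler_norml.
  have tI : t \in `[0, T] by rewrite in_itv.
  have sI : s \in `[0, T] by rewrite in_itv.
  have := Hreg H H12 t s x y p p tI sI Qx Qy.
  rewrite subrr normr0 addr0 => /(le_trans (ler_norm _)) h1.
  have [||h2 _] := Hk t s `|x - y| tT sT.
  - by apply: le_trans ts _; move: dk2; clear; lra.
  - by rewrite normr_ge0/= (le_trans xy)//; move: eeps; clear; lra.
  exact: le_trans h1 h2.
have ne0 : e != 0 by rewrite gt_eqF.
have nne0 : - e != 0 by rewrite oppr_eq0.
have ae : `|e| = e by rewrite gtr0_norm.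
have ane : `|- e| = e by rewrite normrN.
have td3 t : t <= t2 -> t + 2 * d <= t3 by move: dt; clear; lra.
have xr3 (x : R) : `|x| <= R0 -> `|x| + 2 * e <= r by rewrite /r; move: e1; clear; lra.
have [sub1 sub2] := FLtm_interior u_sub.
have conv H x : p_convex T H -> forall t, 0 <= t <= T -> convex_function [set: convex_lmodType R^o] (H t x).
  by move=> cH t tT; apply: cH; rewrite in_itv.
have CS1 := @C1plane_smooth _ e d w cw; have CS2 := @C1plane_smooth _ (- e) d w cw.
have [cx1 ct1 _ _] := CS1; have [cx2 ct2 _ _] := CS2.
have ineq1 x t : 0 <= x -> x <= R0 -> 0 < t -> t <= t2 ->
    smooth_t e d w (x, t) + H1 t x (smooth_x e d w (x, t)) <= k t + 2 * eta1.
  move=> x0 xR t0 tt2.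
  have pos y : 0 < y -> y <= R0 ->
      smooth_t e d w (y, t) + H1 t y (smooth_x e d w (y, t)) <= k t + 2 * eta1.
    move=> y0 yR.
    have := @smooth_interior_subsolution R T _ H1 u k M r L t3 eta1 e d y t (y / 2)
      sub1 u_cont uM Lge0 lipu ik _ (fun t => conv H1 y H1_convex t) ne0 d0 t0 (td3 t tt2) t3T.
    rewrite ae -/w => hS.
    have : smooth_t e d w (y, t) + H1 t y (smooth_x e d w (y, t)) <= k t + eta1 + d^-1 * (2 * (L * e)).
      apply: hS.
      - by apply: Hclose; left.
      - by apply: xr3; rewrite ger0_norm// ltW.
      - by rewrite divr_gt0.
      - move=> y1 y2; rewrite /between min_l ?max_r ?lerDl ?(ltW e0)// => /andP[h1 h2] h3.
        by rewrite /= in_itv/= andbT; move: h3; rewrite ler_norml; move: y0 h1; clear; lra.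
    by move: Le_eta; clear; lra.
  have [x00|] := eqVneq x 0; last by move=> xn0; apply: pos => //; rewrite lt_neqAle eq_sym xn0.
  rewrite x00.
  apply: (@le_right_limit0 _ (fun y => smooth_t e d w (y, t) + H1 t y (smooth_x e d w (y, t))) _ R0) => //.
  move=> y; apply: cvgD; first exact: (continuous2_l (t := t) ct1).
  have tI : t \in `[0, T] by rewrite in_itv/= ltW//= ltW// (le_lt_trans tt2).
  have cH := H1_meas.2 t tI.
  apply: (continuous2_comp cH (a := id) (b := fun y => smooth_x e d w (y, t))) => [y'|]; first exact: cvg_id.
  exact: (continuous2_l cx1).
have ineq2 x t : x <= 0 -> - R0 <= x -> 0 < t -> t <= t2 ->
    smooth_t (- e) d w (x, t) + H2 t x (smooth_x (- e) d w (x, t)) <= k t + 2 * eta1.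
  move=> x0 xR t0 tt2.
  have neg y : y < 0 -> - R0 <= y ->
      smooth_t (- e) d w (y, t) + H2 t y (smooth_x (- e) d w (y, t)) <= k t + 2 * eta1.
    move=> y0 yR.
    have := @smooth_interior_subsolution R T _ H2 u k M r L t3 eta1 (- e) d y t (- y / 2)
      sub2 u_cont uM Lge0 lipu ik _ (fun t => conv H2 y H2_convex t) nne0 d0 t0 (td3 t tt2) t3T.
    rewrite ane -/w => hS.
    have : smooth_t (- e) d w (y, t) + H2 t y (smooth_x (- e) d w (y, t)) <= k t + eta1 + d^-1 * (2 * (L * e)).
      apply: hS.
      - by apply: Hclose; right.
      - by apply: xr3; rewrite ltr0_norm//; move: yR; clear; lra.
      - by rewrite divr_gt0// oppr_gt0.
      - move=> y1 y2; rewrite /between min_r ?max_l ?gerDl ?oppr_le0 ?(ltW e0)// => /andP[h1 h2] h3.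
        by rewrite /= in_itv/=; move: h3; rewrite ler_norml; move: y0 h2; clear; lra.
    by move: Le_eta; clear; lra.
  have [x00|] := eqVneq x 0; last by move=> xn0; apply: neg => //; rewrite lt_neqAle xn0.
  rewrite x00.
  have := @le_right_limit0 _ (fun y => smooth_t (- e) d w (- y, t) + H2 t (- y) (smooth_x (- e) d w (- y, t))) (k t + 2 * eta1) R0 _ R00 _.
  rewrite oppr0; apply; last by move=> y y0 yR; apply: neg; rewrite ?oppr_lt0// lerN2.
  have cN : continuous (fun y : R => - y) by move=> y; exact: (cvgN cvg_id).
  have cc : continuous (fun _ : R => t) by move=> y; exact: cvg_cst.
  move=> y; apply: cvgD; first exact: (continuous2_comp ct2 cN cc).
  have tI : t \in `[0, T] by rewrite in_itv/= ltW//= ltW// (le_lt_trans tt2).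
  have cH := H2_meas.2 t tI.
  exact: (continuous2_comp cH cN (continuous2_comp cx2 cN cc)).
have ineqA t ee : 0 < t -> t <= t2 -> smooth_t ee d w (0, t) + A t <= k t + 2 * eta1.
  move=> t0 tt2.
  have := @smooth_junction_subsolution R T H1 H2 phat1 phat2 A u k M L t3 eta1 ee d t
    u_sub u_cont uM Lge0 lipu1 ik iA _ d0 t0.
  move=> hS; have : smooth_t ee d w (0, t) + A t <= k t + eta1; last by move: eta10; clear; lra.
  apply: hS => //.
    move=> t' s tT sT ts; have [||_ //] := Hk t' s 0 tT sT.
      by apply: le_trans ts _; move: dk2 d0; clear; lra.
    by rewrite lexx ltW.
  by have := td3 t tt2; move: d0; clear; lra.
have wlip y1 y2 s : `|y1| <= r -> `|y2| <= r -> `|w (y1, s) - w (y2, s)| <= L * `|y1 - y2|.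
  move=> h1 h2; rewrite /w /corrected /= opprB addrA subrK.
  have /andP[b1 b2] := clamp_itv s t30.
  by apply: lipu => //; exact: le_lt_trans t3T.
have close ee x t : ee != 0 -> `|ee| = e -> `|x| <= R0 -> 0 <= t -> t <= t2 ->
    `|smooth ee d w (x, t) - w (x, t)| <= 2 * sg.
  move=> ee0 eee xR t0 tt2.
  have -> : 2 * sg = 2 * (sg / 2) + sg by clear; field.
  have near x0 y s : `|x0| <= R0 -> between x0 (x0 + ee) y -> `|w (y, s) - w (x0, s)| <= sg / 2.
    move=> x0R /between_dist; rewrite eee => h1.
    apply: (le_trans _ Le_sg); apply: (le_trans (wlip _ _ _ _ _)).
    - have := xr3 _ x0R; have := ler_normD (y - x0) x0; rewrite subrK.
      by move: h1 e0; clear; lra.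
    - by have := xr3 _ x0R; move: e0; clear; lra.
    - by rewrite ler_wpM2l.
  apply: smooth_dist => //.
  - by rewrite gt_eqF.
  - by move=> y s _; apply: near; rewrite normr0 ltW.
  - by move=> y s _; exact: near.
  - move=> s /(between_lt0 (ltW d0))/andP[s1 s2].
    apply: (Hdw (x, t) (x, s)) => /=.
    + by rewrite (le_trans xR)// lerDl ltW.
    + by rewrite ger0_norm// (le_trans tt2)// (le_trans (ltW t2T))// lerDr ltW.
    + by rewrite subrr normr0 ltW.
    + by rewrite ger0_norm ?subr_ge0//; move: s2 ddw; clear; lra.
pose psi := glue (smooth e d w) (smooth (- e) d w).
have closeG x t : `|x| <= R0 -> 0 <= t -> t <= t2 -> `|psi (x, t) - w (x, t)| <= 2 * sg.
  by move=> xR t00 tt2; rewrite /psi /glue; case: ifP => _; apply: close.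
have s12 t : smooth e d w (0, t) = smooth (- e) d w (0, t) by rewrite !smooth0.
(* The maximum of this function minus the barrier is a contact point of v with
   int (-k) + psi - penalties. *)
pose g z := psi z - v (z.1, clamp t3 z.2) - F (clamp t3 z.2) - (eta * z.2 + kap * `|z.1|).
have cg : continuous g.
  have cv := continuous_clamp t30 t3T v_cont.
  have cF : continuous (fun z : R * R => F (clamp t3 z.2)).
    exact: (continuous_Rint_clamp ik t30 (ltW t3T)).
  have cpsi := continuous_glue (C1plane_continuous CS1) (C1plane_continuous CS2) s12.
  move=> z; apply: cvgB; first by apply: cvgB; [apply: cvgB; [exact: cpsi|exact: cv]|exact: cF].
  apply: cvgD; first by apply: cvgM; [exact: cvg_cst|exact: continuous2_snd].
  by apply: cvgM; [exact: cvg_cst|apply: cvg_norm; exact: continuous2_fst].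
have gE x t : 0 <= t -> t <= t3 -> g (x, t) = psi (x, t) - v (x, t) - F t - (eta * t + kap * `|x|).
  by move=> t0' tt; rewrite /g /= clamp_id.
have [||||||sp [la [xs [ts [sp0 la0 xsr /andP[ts0 ts2] HM]]]]] :=
    @box_max R g R0 0 t1 t2 (3 * sg) x1 cg.
- exact: R0x1.
- exact: ltW.
- exact: t12.
- move=> x xR; rewrite (gE x 0 (lexx _) t30).
  have := closeG x 0 xR (lexx _) t20; rewrite wE// ler_norml => /andP[_ h1].
  have /andP[f1 _] := F0 0 (lexx _) (ltW T_gt0).
  have : 0 <= kap * `|x| by rewrite mulr_ge0// ltW.
  rewrite mulr0; have := uv0 x; move: h1 f1 sg0; clear; lra.
- move=> x t xR /andP[t0 tt]; rewrite (gE x t t0 (le_trans tt (ltW t23))).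
  have tT := le_lt_trans tt t2T.
  have xR' : `|x| <= R0 by rewrite xR.
  have := closeG x t xR' t0 tt; rewrite wE ?(le_trans tt (ltW t23))// ler_norml => /andP[_ h1].
  have /andP[f1 _] := F0 t t0 (ltW tT).
  have /andP[q1 _] := etaT t t0 (ltW tT).
  have := uM x t t0 tT; have := vM x t t0 tT; rewrite !ler_norml xR => /andP[v1 _] /andP[_ u1].
  move: h1 f1 q1 v1 u1 R0M sg0; clear; lra.
- have t13 := ltW (lt_trans t12 t23).
  rewrite (gE x1 t1 (ltW t10) t13).
  have := closeG x1 t1 R0x1 (ltW t10) (ltW t12); rewrite wE ?(ltW t10)// ler_norml => /andP[h1 _].
  have /andP[_ f1] := F0 t1 (ltW t10) (ltW t1T).
  have /andP[_ q1] := etaT t1 (ltW t10) (ltW t1T).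
  have E : u (x1, t1) - v (x1, t1) = 16 * sg by rewrite /sg; clear; field.
  move: h1 f1 q1 kapx1 sg0 E; clear; lra.
have tsT := lt_trans ts2 t2T.
have CT1 := C1planeD CS1 (C1planeD (C1plane_linform (- kap) (- eta)) (C1plane_barrier (- sp) la t1)).
have CT2 := C1planeD CS2 (C1planeD (C1plane_linform kap (- eta)) (C1plane_barrier (- sp) la t1)).
have eqT t : smooth e d w (0, t) + (linform (- kap) (- eta) (0, t) + barrier (- sp) la t1 (0, t)) =
  smooth (- e) d w (0, t) + (linform kap (- eta) (0, t) + barrier (- sp) la t1 (0, t)).
  by rewrite s12 /linform /= !mulr0.
have penN z : barrier (- sp) la t1 z = - barrier sp la t1 z by rewrite /barrier mulNr.
have pentN z : barrier_t (- sp) la t1 z <= 0.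
  by have := barrier_t_gt0 t1 z sp0 la0; rewrite /barrier_t mulNr oppr_le0 => /ltW.
pose dd := Num.min (R0 - `|xs|) (Num.min (ts / 2) (t2 - ts)).
have dd0 : 0 < dd by rewrite !lt_min divr_gt0// !subr_gt0 xsr ts2.
have [ddx ddt1 ddt2] : [/\ dd <= R0 - `|xs|, dd <= ts / 2 & dd <= t2 - ts].
  by rewrite /dd !ge_min !lexx !orbT.
have indd t : `|t - ts| <= dd -> 0 < t /\ t <= t2.
  by rewrite ler_norml; move: ddt1 ddt2 ts0; clear; split; lra.
have inddx x : `|x - xs| <= dd -> `|x| <= R0.
  by have := ler_normD (x - xs) xs; rewrite subrK; move: ddx; clear; lra.
have [|J I1 I2] := FLtm_test v_super (L1N ik) CT1 CT2 eqT ts0 tsT (x0 := xs).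
  move=> w'; apply/nbhs2P; exists dd => // -[x t] /= h1 h2 t0 tT.
  have [_ tt2] := indd t (ltW h2).
  have tI : 0 <= t <= t2 by rewrite ltW.
  have := HM x t (inddx x (ltW h1)) tI.
  rewrite (gE x t (ltW t0) (le_trans tt2 (ltW t23))) (gE xs ts (ltW ts0) (ltW (lt_trans ts2 t23))).
  have glueE x' t' : glue (fun z => smooth e d w z + (linform (- kap) (- eta) z + barrier (- sp) la t1 z))
     (fun z => smooth (- e) d w z + (linform kap (- eta) z + barrier (- sp) la t1 z)) (x', t') =
     psi (x', t') - (eta * t' + kap * `|x'|) - barrier sp la t1 (x', t').
    rewrite /psi /glue /= !penN /linform /=; case: (leP 0 x') => x'0.
      by rewrite ger0_norm//; clear; ring.
    by rewrite ltr0_norm//; clear; ring.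
  rewrite /w' !glueE !(Rint_opp _ ik) ?(ltW tT) ?(ltW tsT)// -!/(F _).
  clear; lra.
have small : 2 * eta1 + c * kap < eta by rewrite /eta1; move: ckap eta0; clear; lra.
have kapn : `|- kap + 0| <= kap by rewrite addr0 normrN gtr0_norm.
have kapp : `|kap + 0| <= kap by rewrite addr0 gtr0_norm.
have [xs0|xs0|xs0] := ltgtP xs 0.
- apply: (no_touching_inside cx2 ct2 Hl2 c0 dd0 _ (I2 xs0) _ _ small).
  + move=> x t; rewrite /= in_itv/= => x0 /inddx xR /indd[t0 tt2].
    by apply: ineq2 => //; [exact: ltW|move: xR; rewrite ler_norml => /andP[]].
  + by rewrite [X in `|X|]addrAC subrr add0r.
  + by have := pentN (xs, ts); clear; lra.
- apply: (no_touching_inside cx1 ct1 Hl1 c0 dd0 _ (I1 xs0) _ _ small).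
  + move=> x t; rewrite /= in_itv/= andbT => x0 /inddx xR /indd[t0 tt2].
    by apply: ineq1 => //; [exact: ltW|move: xR; rewrite ler_norml => /andP[]].
  + by rewrite [X in `|X|]addrAC subrr add0r.
  + by have := pentN (xs, ts); clear; lra.
- rewrite xs0 in inddx.
  apply: (no_touching_at_junction cx1 ct1 cx2 ct2 phat1_min phat2_min Hl1 Hl2 c0 dd0 _ _ _ _ (J xs0) _ _ _ small).
  + move=> x t x0 xd /indd[t0 tt2]; apply: ineq1 => //.
    by rewrite -(ger0_norm x0) inddx// subr0.
  + move=> x t x0 xd /indd[t0 tt2]; apply: ineq2 => //.
    by rewrite lerNl -(ler0_norm x0) inddx// subr0.
  + by move=> t /indd[t0 tt2]; exact: ineqA.
  + by rewrite !smooth_t0.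
  + by rewrite [X in `|X|]addrAC subrr add0r.
  + by rewrite [X in `|X|]addrAC subrr add0r.
  + by have := pentN (0, ts); clear; lra.
Qed.
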